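(* Let $n\ge 1$ and let $\alpha_1,\dots,\alpha_n\in F\setminus\{0\}$. If $$\mathrm{Id}^{tr}\big(D_n^{t_{\alpha_1,\dots,\alpha_n}}\big)=\langle f_1(x_1,\dots,x_k),\dots,f_s(x_1,\dots,x_h),[x_1,x_2]\rangle_{T^{tr}}$$ for some trace polynomials $f_1,\dots,f_s$, then $$\mathrm{Id}^{tr}\big(D_{n+1}^{t_{\alpha_1,\dots,\alpha_n,0}}\big)=\langle \mathrm{Tr}(f_1(x_1,\dots,x_k)x_{k+1}),\dots,\mathrm{Tr}(f_s(x_1,\dots,x_h)x_{h+1}),[x_1,x_2]\rangle_{T^{tr}}.$$ (Each $f_i$ is multiplied by a variable not occurring in it.)
   Context: $F$ is a field of characteristic zero; all algebras are associative, unitary, over $F$. An algebra with trace is an algebra $A$ with a linear map $\mathrm{tr}\colon A\to F$ such that $\mathrm{tr}(ab)=\mathrm{tr}(ba)$ for all $a,b\in A$; $F$ is identified with $F\cdot 1_A\subseteq A$. Let $X=\{x_1,x_2,\dots\}$ and let $\mathcal M$ be the set of (nonempty) monomials in the noncommuting variables of $X$. The free algebra with trace is $F\langle X,\mathrm{Tr}\rangle\cong F\langle X\rangle\otimes F[\mathrm{Tr}(M)\mid M\in\mathcal M]$, where the $\mathrm{Tr}(M)$ are central commuting variables subject to $\mathrm{Tr}(MN)=\mathrm{Tr}(NM)$ and $\mathrm{Tr}(\mathrm{Tr}(M)N)=\mathrm{Tr}(M)\mathrm{Tr}(N)$; $\mathrm{Tr}$ is extended linearly. Its elements are called trace polynomials;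 the symbol $\mathrm{Tr}(1)$ does not occur. A trace polynomial is pure if all its variables appear inside traces. A trace polynomial $f(x_1,\dots,x_n,\mathrm{Tr})$ is a trace identity of $A$ if it vanishes whenever the $x_i$ are replaced by arbitrary elements of $A$ and $\mathrm{Tr}$ by $\mathrm{tr}$. $\mathrm{Id}^{tr}(A)$ is the set of all trace identities of $A$. A $T^{tr}$-ideal is an ideal of $F\langle X,\mathrm{Tr}\rangle$ invariant under all endomorphisms (substitutions of the variables by linear combinations, with coefficients in $F[\mathrm{Tr}(M)\mid M\in\mathcal M]$, of nonempty monomials, compatibly with $\mathrm{Tr}$) and closed under taking traces ($f\mapsto \mathrm{Tr}(fM)$ for $M\in\mathcal M$, and $f\mapsto\mathrm{Tr}(f)$ when $f$ has no pure trace term). $\langle f_1,\dots,f_k\rangle_{T^{tr}}$ denotes the smallest $T^{tr}$-ideal containing $f_1,\dots,f_k$. $[x_1,x_2]=x_1x_2-x_2x_1$. $D_n$ is the algebra of $n\times n$ diagonal matrices over $F$, and $D_n^{t_{\alpha_1,\dots,\alpha_n}}$ is $D_n$ with the trace $t_{\alpha_1,\dots,\alpha_n}(\mathrm{diag}(a_{11},\dots,a_{nn}))=\alpha_1a_{11}+\cdots+\alpha_na_{nn}$. *)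

(* Defs.v *)
From HB Require Import structures.
From mathcomp Require Import all_boot all_order all_algebra.
From mathcomp Require Import finmap.
From mathcomp.multinomials Require Import monalg.

Set Implicit Arguments.
Unset Strict Implicit.
Unset Printing Implicit Defensive.

Import GRing.Theory.
Local Open Scope ring_scope.

(* Variables are indexed from 0: the letter i : nat stands for x_{i+1}.      *)
Definition word := {w : seq nat | w != [::]}.

Definition cyclic_eq (u v : word) : bool :=
  has (fun k => val u == rot k (val v)) (iota 0 (size (val v)).+1).

Lemma cyclic_eqP (u v : word) :
  reflect (exists k, val u = rot k (val v)) (cyclic_eq u v).
Proof.
apply: (iffP hasP) => [[k _ /eqP ->]|[k e]]; first by exists k.
case: (leqP k (size (val v))) => [le_k|lt_k].
  by exists k; [rewrite mem_iota ltnS | apply/eqP].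
by exists 0; [rewrite mem_iota | rewrite e rot0 rot_oversize // ltnW].
Qed.

Lemma cyclic_eq_cat (u v : word) :
  cyclic_eq u v <-> exists s t, val u = s ++ t /\ val v = t ++ s.
Proof.
split=> [/cyclic_eqP[k eu]|[s [t [eu ev]]]].
  by exists (drop k (val v)), (take k (val v)); rewrite eu cat_take_drop.
by apply/cyclic_eqP; exists (size t); rewrite eu ev rot_size_cat.
Qed.

Lemma cyclic_eq_refl : reflexive cyclic_eq.
Proof. by move=> u; apply/cyclic_eqP; exists 0; rewrite rot0. Qed.

Lemma cyclic_eq_sym : symmetric cyclic_eq.
Proof.
by move=> u v; apply/idP/idP => /cyclic_eq_cat[s [t [eu ev]]];
  apply/cyclic_eq_cat; exists t, s.
Qed.

Lemma cyclic_eq_trans : transitive cyclic_eq.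
Proof.
have bound (w : seq nat) k : exists2 l, (l <= size w)%N & rot k w = rot l w.
  case: (leqP k (size w)) => [le_k|lt_k]; first by exists k.
  by exists 0; rewrite // rot0 rot_oversize // ltnW.
move=> v u w /cyclic_eqP[k eu] /cyclic_eqP[l ev]; apply/cyclic_eqP.
rewrite {}eu {}ev; have [l' le_l ->] := bound (val w) l.
have [k' le_k ->] := bound (rot l' (val w)) k.
by rewrite size_rot in le_k; rewrite rot_add_mod //; eexists.
Qed.

Canonical cyclic_eq_equiv :=
  EquivRel cyclic_eq cyclic_eq_refl cyclic_eq_sym cyclic_eq_trans.

(* Nonempty words modulo uv ~ vu: the indices M of the symbols Tr(M).        *)
Definition cword := {eq_quot cyclic_eq}%qT.

(* F[Tr(M)] and F<X, Tr> = F<X> (x) F[Tr(M)], the latter being realised as   *)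
(* the monoid algebra of the free monoid on X over the ring F[Tr(M)].        *)
Notation trpure F := {malg F[{cmonom cword}]}.
Notation trpoly F := {malg (trpure F)[{fmonom nat}]}.

Section FreeTraceAlgebra.
Variable F : fieldType.
Implicit Types (f : trpoly F) (p : trpure F) (w : {fmonom nat}).

Definition trvar (i : nat) : trpoly F := << fmu i >>.

(* Tr(1) is not a symbol of the algebra; the value at the empty word is a    *)
(* dummy, never reached by the definitions below, which apply Tr only to     *)
(* elements satisfying no_pure_term.                                         *)
Definition Trw w : trpure F :=
  if insub (w : seq nat) is Some u then << ucm (\pi_cword u)%qT >> else 0.

Definition Tr f : trpure F := mmap idfun Trw f.

Lemma TrwE w (w0 : (w : seq nat) != [::]) :
  Trw w = << ucm (\pi_cword (exist _ (w : seq nat) w0))%qT >>.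
Proof. by rewrite /Trw insubT. Qed.

Lemma TrwC (v w : {fmonom nat}) : Trw (mmul v w) = Trw (mmul w v).
Proof.
have [->|v0] := eqVneq v mone; first by rewrite mul1m mulm1.
have neq0 (u : {fmonom nat}) : u != mone -> (u : seq nat) != [::].
  by apply: contraNneq => u0; rewrite -fdeg_eq0 fdegE u0.
have vw0 : (mmul v w : seq nat) != [::].
  by apply: neq0; rewrite fmM_eq1 negb_and v0.
have wv0 : (mmul w v : seq nat) != [::].
  by apply: neq0; rewrite fmM_eq1 negb_and v0 orbT.
have e : (\pi_cword (exist _ (mmul v w : seq nat) vw0))%qT
    = (\pi_cword (exist _ (mmul w v : seq nat) wv0))%qT.
  apply/eqmodP/cyclic_eq_cat.
  by exists (fmonom_val v), (fmonom_val w); rewrite /= !fmM.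
by rewrite (TrwE vw0) (TrwE wv0) e.
Qed.

Lemma TrM f (g : trpoly F) : Tr (f * g) =
  \sum_(v <- msupp f) \sum_(w <- msupp g) f@_v * g@_w * Trw (mmul v w).
Proof.
rewrite malgME /Tr raddf_sum; apply: eq_bigr => v _.
rewrite raddf_sum; apply: eq_bigr => w _; exact: mmapU.
Qed.

Lemma TrC f (g : trpoly F) : Tr (f * g) = Tr (g * f).
Proof.
apply: etrans (TrM f g) (etrans _ (esym (TrM g f))).
rewrite exchange_big; apply: eq_bigr => v _; apply: eq_bigr => w _.
by rewrite (TrwC w v) [f@_w * g@_v]mulrC.
Qed.

(* The pure part of f is its coefficient, in F[Tr(M)], at the empty word.     *)
Definition no_pure_term f : bool := f@_mone == 0.

Definition vars_below (k : nat) f : bool :=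
  all (fun w : {fmonom nat} =>
         all (ltn^~ k) w &&
         all (fun m : {cmonom cword} =>
                all (fun c : cword => all (ltn^~ k) (val (repr c))) (finsupp m))
             (msupp f@_w))
      (msupp f).

End FreeTraceAlgebra.

Arguments trvar {F} i.

(* Replace x_i by phi i and Tr by tau, the coefficients being mapped by iota.*)
(* The value at a cyclic word is computed on a representative; it does not   *)
(* depend on it as soon as tau (a * b) = tau (b * a), see trsubst_pureTrw.   *)
Section Substitution.
Variables (F : fieldType) (S : comNzRingType) (B : lalgType S).
Variables (iota : F -> S) (tau : B -> S) (phi : nat -> B).

Definition prodw (w : seq nat) : B := \prod_(i <- w) phi i.

Definition trsubst_pure (p : trpure F) : S :=
  mmap iota (fun m : {cmonom cword} =>
    \prod_(c <- finsupp m) tau (prodw (val (repr c))) ^+ m c) p.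

Definition trsubst (f : trpoly F) : B :=
  mmap (fun p => (trsubst_pure p)%:A) (fun w => prodw (w : {fmonom nat})) f.

End Substitution.

Lemma trsubst_pureTrw (F : fieldType) (S : comNzRingType) (B : lalgType S)
    (iota : {rmorphism F -> S}) (tau : B -> S) (phi : nat -> B)
    (w : {fmonom nat}) :
    (forall a b, tau (a * b) = tau (b * a)) -> (w : seq nat) != [::] ->
  trsubst_pure iota tau phi (Trw F w) = tau (prodw phi w).
Proof.
move=> tauC w0; rewrite /Trw insubT /trsubst_pure mmapU /= rmorph1 mul1r.
rewrite mdomU big_seq_fset1 cmUU expr1.
set u := Sub _ _; have /eqmodP := reprK (\pi_cword u)%qT.
move=> /cyclic_eq_cat[s [t [-> /= ->]]].
by rewrite /prodw !big_cat /= tauC.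
Qed.

Section TraceIdeals.
Variable F : fieldType.

Definition endo (phi : nat -> trpoly F) : trpoly F -> trpoly F :=
  trsubst (fun a => a%:MP) (@Tr F) phi.

Record Ttr_ideal (I : trpoly F -> Prop) : Prop := {
  Ttr_ideal0 : I 0;
  Ttr_idealD : forall f g, I f -> I g -> I (f + g);
  Ttr_idealMl : forall a f, I f -> I (a * f);
  Ttr_idealMr : forall f a, I f -> I (f * a);
  Ttr_ideal_endo : forall (phi : nat -> trpoly F) f,
    (forall i, no_pure_term (phi i)) -> I f -> I (endo phi f);
  Ttr_ideal_TrM : forall f (w : {fmonom nat}),
    w != mone -> I f -> I (Tr (f * << w >>))%:MP;
  Ttr_ideal_Tr : forall f, no_pure_term f -> I f -> I (Tr f)%:MP }.

Definition Ttr_span (G : trpoly F -> Prop) (f : trpoly F) : Prop :=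
  forall I, Ttr_ideal I -> (forall g, G g -> I g) -> I f.

End TraceIdeals.

Record traceAlgType (F : fieldType) := TraceAlgebra {
  tralg_sort :> algType F;
  tralg_tr : {scalar tralg_sort};
  tralg_trC : forall a b, tralg_tr (a * b) = tralg_tr (b * a) }.

Definition tr_identity (F : fieldType) (A : traceAlgType F) (f : trpoly F) :
    Prop :=
  forall phi : nat -> A, trsubst idfun (@tralg_tr F A) phi f = 0.

Section DiagonalMatrices.
Variables (F : fieldType) (n : nat).

(* The algebra D_{n+1}. *)
Record diagmx := DiagMx { diagmx_val :> 'M[F]_n.+1; _ : is_diag_mx diagmx_val }.

HB.instance Definition _ := [isSub for diagmx_val].
HB.instance Definition _ := [Choice of diagmx by <:].

Lemma is_diag_mxM (A B : 'M[F]_n.+1) :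
  is_diag_mx A -> is_diag_mx B -> is_diag_mx (A *m B).
Proof.
by move=> /diag_mxP[d ->] /diag_mxP[e ->]; rewrite mulmx_diag.
Qed.

Lemma is_diag_mx_subalg : GRing.subalg_closed (@is_diag_mx F n.+1 n.+1).
Proof.
split=> [|a A B|A B]; first exact: scalar_mx_is_diag.
  move=> /is_diag_mxP dA /is_diag_mxP dB; apply/is_diag_mxP => i j ij.
  by rewrite !mxE dA // dB // mulr0 addr0.
exact: is_diag_mxM.
Qed.

HB.instance Definition _ := GRing.SubChoice_isSubAlgebra.Build
  F 'M[F]_n.+1 _ diagmx (GRing.subalg_closed_semi is_diag_mx_subalg).

Variable alpha : 'I_n.+1 -> F.

Definition wtrace (A : diagmx) : F := \sum_i alpha i * A i i.

Lemma wtrace_is_linear : linear_for *%R wtrace.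
Proof.
move=> a A B; rewrite /wtrace mulr_sumr -big_split; apply: eq_bigr => i _ /=.
by rewrite !mxE mulrDr mulrCA.
Qed.

HB.instance Definition _ :=
  GRing.isLinear.Build F diagmx F *%R wtrace wtrace_is_linear.

Lemma wtraceC (A B : diagmx) : wtrace (A * B) = wtrace (B * A).
Proof.
rewrite /wtrace; apply: eq_bigr => i _; congr (_ * _).
case: A B => [A dA] [B dB] /=.
have [d ->] := diag_mxP _ dA; have [e ->] := diag_mxP _ dB.
by rewrite -!mulmxE !mulmx_diag !mxE mulrC.
Qed.

Definition diagmx_tr : traceAlgType F := TraceAlgebra (tralg_tr := wtrace) wtraceC.

End DiagonalMatrices.

(* (alpha_1, ..., alpha_n) |-> (alpha_1, ..., alpha_n, 0) *)
Definition rcons0 (F : fieldType) (n : nat) (alpha : 'I_n -> F) (i : 'I_n.+1) : F :=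
  if unlift ord_max i is Some j then alpha j else 0.

(* Main.v *)
Require Import Defs.
From HB Require Import structures.
From mathcomp Require Import all_boot all_order all_algebra.
From mathcomp Require Import finmap.
From mathcomp.multinomials Require Import monalg.

Set Implicit Arguments.
Unset Strict Implicit.
Unset Printing Implicit Defensive.

Import GRing.Theory.
Local Open Scope ring_scope.

(** Write D for the diagonal matrices with the nonzero weights, D' for those
    with one more coordinate, of weight zero, and J for the T-ideal generated by
    the Tr(f_i x) and the commutator.

    J consists of identities of D': the trace of D' only sees the coordinates of
    D, where f_i vanishes ([Tr_mul_var_identity]).

    Conversely let g be an identity of D'.  Modulo commutators g is a sum of
    p_w w, where w runs over the sorted words and the p_w are pure
    ([collect_words]).  On the last coordinate the variables take arbitrary
    values independent of the traces, so every p_w is an identity of D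
    ([trace_identity_sections]).  It remains to prove that a pure identity p of
    D belongs to J ([pure_identity_mem]).

    The trace of D is nondegenerate.  Hence the cyclic derivatives g_i of p,
    defined by the linear part of p (x + y) being the sum of the Tr(g_i y_i),
    are identities of D ([cyclic_deriv_identity]), and Euler's identity says
    that, modulo commutators, the sum of the Tr(g_i x_i) is the degree times p
    if p is homogeneous ([Euler_identity]).  So it would be enough to know that
    Tr(g a) lies in J for all identities g of D.  The elements g with this
    property contain the f_i and the commutator, and they are stable under all
    the operations that define a T-ideal, except that for g = Tr(f) one needs
    Tr(f) Tr(a) in J, that is, essentially, that the pure identity Tr(f) lies in
    J already.

    The circle is broken by the degree, since Tr(f) Tr(a) has larger degree than
    Tr(f).  One proves by induction on m that every pure identity of D is
    congruent to an element of J modulo elements of order at least m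
    ([near_Tr_mul], [near_pure_identity]).  Since F is infinite, T-ideals are
    graded ([homogeneous_parts]), so an element that is approximated by J to all
    orders lies in J ([near_limit]). *)

(** * Free monoid algebras and monomials with traces *)

Lemma malgUM (K : monomType) (R : nzRingType) (k1 k2 : K) (c1 c2 : R) :
  << c1 *g k1 >> * << c2 *g k2 >> = << c1 * c2 *g mmul k1 k2 >> :> {malg R[K]}.
Proof. by rewrite malgM_def fgmulUU. Qed.

Lemma raddf_monalgE (K : choiceType) (R V : zmodType)
    (h : {additive {malg R[K]} -> V}) (g : {malg R[K]}) :
  h g = \sum_(k <- msupp g) h << g@_k *g k >>.
Proof. by rewrite {1}[g]monalgE raddf_sum. Qed.

Lemma sum_mul_sum (R : pzRingType) (I J : Type) (r : seq I) (t : seq J)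
    (f : I -> R) (g : J -> R) :
  (\sum_(i <- r) f i) * (\sum_(j <- t) g j)
    = \sum_(i <- r) \sum_(j <- t) f i * g j.
Proof. exact: big_distrlr. Qed.

Lemma scale_regroup (R : comNzRingType) (V : lmodType R) (a b c d : R) (v : V) :
  (a * (b * c)) *: (d *: v) = (b * d) *: ((a * c) *: v).
Proof. by rewrite !scalerA (mulrCA a b c) (mulrAC b _ d). Qed.

Lemma mcoeff_moneM (K : monomType) (R : nzRingType) (f g : {malg R[K]}) :
  (f * g)@_mone = f@_mone * g@_mone.
Proof. exact: rmorphM (mcoeff mone) f g. Qed.

Section MalgScale.
Variables (K : monomType) (R : comNzRingType).
Implicit Types (p q : R) (f g : {malg R[K]}).

Lemma malgC_central p f : p%:MP * f = f * p%:MP.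
Proof.
rewrite [f]monalgE mulr_sumr mulr_suml; apply: eq_bigr => w _.
by rewrite !malgUM mul1m mulm1 mulrC.
Qed.

Lemma malg_scalerAr p f g : p *: (f * g) = f * (p *: g).
Proof. by rewrite -!mul_malgC mulrA malgC_central -mulrA. Qed.

Lemma malg_scaleMM p q f g : (p *: f) * (q *: g) = (p * q) *: (f * g).
Proof. by rewrite -scalerAl -malg_scalerAr scalerA. Qed.

Lemma malg_scaleM p q p' q' f g :
  ((p * q) *: f) * ((p' * q') *: g) = ((p * p') * (q * q')) *: (f * g).
Proof. by rewrite malg_scaleMM mulrACA. Qed.

Lemma malgU_big (I : Type) (r : seq I) (k : I -> K) :
  \prod_(i <- r) << k i >> = << \big[mmul/mone]_(i <- r) k i >> :> {malg R[K]}.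
Proof.
elim: r => [|i r IH]; first by rewrite !big_nil.
by rewrite !big_cons IH malgUM mulr1.
Qed.

End MalgScale.

HB.lock Definition word (F : fieldType) (w : seq nat) : trpoly F :=
  << FMonom w >>.

(** A term (c, [:: u_1; ...; u_k], w) stands for the monomial
    c * Tr(u_1) ... Tr(u_k) * w, the u_j and w being words in the variables. *)
Notation trterm F := (F * seq (seq nat) * seq nat)%type.

Section Words.
Variable F : fieldType.
Implicit Types (f g : trpoly F) (p q : trpure F) (u v w : seq nat).
Implicit Types (s : seq (seq nat)).

Lemma wordE w : word F w = << FMonom w >>.
Proof. by rewrite word.unlock. Qed.

Definition trword u : trpure F := Trw F (FMonom u).
Definition trprod s : trpure F := \prod_(u <- s) trword u.

Lemma word_cat u v : word F (u ++ v) = word F u * word F v.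
Proof.
rewrite !wordE malgUM mulr1; congr (<< _ >>).
by apply/eqP; rewrite fmP fmM.
Qed.

Lemma word_nil : word F [::] = 1.
Proof. by rewrite -mpolyC1E wordE -[mone]fmK fm1. Qed.

Lemma word1 i : word F [:: i] = trvar i.
Proof. by rewrite wordE -fmuE. Qed.

Lemma word_prod w : word F w = \prod_(i <- w) trvar i.
Proof.
elim: w => [|i w IH]; first by rewrite big_nil word_nil.
by rewrite big_cons -IH -word1 -word_cat.
Qed.

Lemma Tr_is_additive : additive (@Tr F).
Proof. by move=> f g; rewrite /Tr raddfB. Qed.

Lemma Tr_is_scalable : scalable_for *%R (@Tr F).
Proof.
move=> p f; apply: etrans (mmapEw (f := idfun) (msuppZ_le p f)) _.
rewrite /Tr mmapE mulr_sumr.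
by apply: eq_bigr => w _; rewrite mcoeffZ mulrA.
Qed.

HB.instance Definition _ :=
  GRing.isAdditive.Build (trpoly F) (trpure F) (@Tr F) Tr_is_additive.
HB.instance Definition _ :=
  GRing.isScalable.Build (trpure F) (trpoly F) (trpure F) *%R (@Tr F)
    Tr_is_scalable.

Lemma Tr_word w : Tr (word F w) = trword w.
Proof. by rewrite /Tr wordE mmapU /= mul1r. Qed.

Lemma trword_nil : trword [::] = 0.
Proof. by rewrite /trword /Trw insubF. Qed.

Lemma trprod_cat s1 s2 : trprod (s1 ++ s2) = trprod s1 * trprod s2.
Proof. by rewrite /trprod big_cat. Qed.

Lemma trprod_cons u s : trprod (u :: s) = trword u * trprod s.
Proof. by rewrite /trprod big_cons. Qed.

End Words.

HB.lock Definition mono (F : fieldType) (c : F) (s : seq (seq nat))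
  (w : seq nat) : trpoly F := (c%:MP * trprod F s) *: word F w.
Arguments mono {F} c s w.

Section Terms.
Variable F : fieldType.
Implicit Types (f g : trpoly F) (u v w : seq nat) (s : seq (seq nat)).

Lemma monoE (c : F) s w : mono c s w = (c%:MP * trprod F s) *: word F w.
Proof. by rewrite mono.unlock. Qed.

Lemma malgCM (a b : F) : (a * b)%:MP = a%:MP * b%:MP :> trpure F.
Proof. exact: rmorphM. Qed.

Lemma monoM (c1 c2 : F) s1 s2 w1 w2 :
  mono c1 s1 w1 * mono c2 s2 w2 = mono (c1 * c2) (s1 ++ s2) (w1 ++ w2).
Proof.
rewrite !monoE; apply: etrans (malg_scaleM _ _ _ _ _ _) _.
by rewrite word_cat trprod_cat malgCM.
Qed.

Lemma Tr_mono (c : F) s w : (Tr (mono c s w))%:MP = mono c (w :: s) [::].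
Proof.
rewrite !monoE linearZ /= Tr_word trprod_cons word_nil -mul_malgC mulr1.
by rewrite -mulrA [trword F w * _]mulrC.
Qed.

Definition letters_below k (x : trterm F) :=
  all (ltn^~ k) (flatten x.1.2 ++ x.2).

Definition mono_of_term (x : trterm F) := mono x.1.1 x.1.2 x.2.
(** An empty trace word would stand for the dummy value 0 of Tr(1), which
    substitutions do not preserve: they send it to the trace of 1. *)
Definition traces_proper (x : trterm F) := [::] \notin x.1.2.
Definition of_terms (L : seq (trterm F)) := \sum_(x <- L) mono_of_term x.

Lemma cmonom_prod (m : {cmonom cword}) :
  << m >> = \prod_(c <- flatten [seq nseq (m c) c | c <- finsupp m]) << ucm c >>
    :> trpure F.
Proof.
rewrite malgU_big.
congr (<< _ >>); apply/eqP/cmP => c.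
have -> (r : seq cword) : (\big[mmul/mone]_(c <- r) ucm c) c = count_mem c r.
  elim: r => [|d r IH]; first by rewrite big_nil cm1.
  by rewrite big_cons cmM IH cmU.
rewrite count_flatten -map_comp sumnE big_map.
rewrite (eq_bigr (fun d => m d * (d == c))%N); last first.
  by move=> d _ /=; rewrite count_nseq mulnC.
have [cm|/negbTE cm] := boolP (c \in finsupp m).
  rewrite (bigD1_seq c) ?fset_uniq //= eqxx muln1 big1 ?addn0 // => d /negbTE.
  by move->; rewrite muln0.
rewrite big_seq big1 => [|d dm]; last first.
  by case: eqP dm => [->|_ _]; rewrite ?cm ?muln0.
by move/negbT: cm; rewrite -cmE_eq0 => /eqP.
Qed.

Lemma trword_repr (c : cword) : trword F (val (repr c)) = << ucm c >>.
Proof.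
rewrite /trword /Trw; case: insubP => [u _ /= e|]; last first.
  by case: (repr c) => w /= ->.
suff -> : u = repr c by rewrite reprK.
exact: val_inj.
Qed.

(** The classes of cyclic words are represented by [repr], as in the definition
    of [trsubst_pure]. *)
Definition cmonom_words (m : {cmonom cword}) : seq (seq nat) :=
  flatten [seq nseq (m c) (val (repr c)) | c <- finsupp m].

Lemma trprod_cmonom_words (m : {cmonom cword}) :
  trprod F (cmonom_words m) = << m >>.
Proof.
rewrite cmonom_prod /trprod.
have -> : cmonom_words m = [seq val (repr c) |
    c <- flatten [seq nseq (m c) c | c <- finsupp m]].
  rewrite map_flatten -map_comp; congr flatten; apply: eq_map => c /=.
  by rewrite map_nseq.
rewrite big_map; apply: eq_bigr => c _; exact: trword_repr.
Qed.

Definition terms f : seq (trterm F) :=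
  flatten [seq [seq ((f@_w)@_m, cmonom_words m, fmonom_val w)
                 | m : {cmonom cword} <- msupp f@_w]
            | w : {fmonom nat} <- msupp f].

Lemma termsK f : of_terms (terms f) = f.
Proof.
rewrite [RHS]monalgE /of_terms /terms big_flatten big_map.
apply: eq_bigr => w _.
rewrite big_map (raddf_monalgE (mkmalgU w)); apply: eq_bigr => m _.
rewrite /mono_of_term monoE /= trprod_cmonom_words malgUM mul1m mulr1.
by rewrite -mul_malgC wordE fmK malgUM mul1m mulr1.
Qed.

Lemma traces_proper_terms f : all traces_proper (terms f).
Proof.
apply/allP => x /flattenP[/= y /mapP[w _ ->]] /mapP[m _ ->].
apply/negP => /flattenP[/= r /mapP[c _ ->]] /nseqP[e _].
by case: (repr c) e => /= w' + e; rewrite -e.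
Qed.

Lemma letters_below_terms k f :
  vars_below k f -> all (letters_below k) (terms f).
Proof.
move=> /allP vf; apply/allP => x /flattenP[/= y /mapP[w wf ->]] /mapP[m mf ->].
have /andP[wk /allP/(_ m mf) /allP mk] := vf w wf.
rewrite /letters_below all_cat wk andbT.
apply/allP => i /flattenP[/= u /flattenP[/= r /mapP[c cm ->]] /nseqP[-> _]].
exact: (allP (mk c cm)).
Qed.

Lemma of_terms_cat L1 L2 : of_terms (L1 ++ L2) = of_terms L1 + of_terms L2.
Proof. by rewrite /of_terms big_cat. Qed.

End Terms.

(** * Substitution homomorphisms *)

Section SubstitutionTheory.
Variables (F : fieldType) (S : comNzRingType) (B : lalgType S).
Variables (iota : {rmorphism F -> S}) (tau : {scalar B}).
Hypothesis scaleBr : forall (a : S) (x y : B), a *: (x * y) = x * (a *: y).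
Hypothesis tauC : forall a b : B, tau (a * b) = tau (b * a).
Implicit Types (phi : nat -> B) (f g : trpoly F) (p q : trpure F).

Lemma prodw_cat phi u v : prodw phi (u ++ v) = prodw phi u * prodw phi v.
Proof. by rewrite /prodw big_cat. Qed.

Lemma prodw_nil phi : prodw phi [::] = 1.
Proof. by rewrite /prodw big_nil. Qed.

Lemma prodw_cons phi i w : prodw phi (i :: w) = phi i * prodw phi w.
Proof. by rewrite /prodw big_cons. Qed.

Definition monom_val phi (m : {cmonom cword}) : S :=
  \prod_(c <- finsupp m) tau (prodw phi (val (repr c))) ^+ m c.

Lemma monom_valEw phi (d : {fset cword}) (m : {cmonom cword}) :
    (finsupp m `<=` d)%fset ->
  monom_val phi m = \prod_(c <- d) tau (prodw phi (val (repr c))) ^+ m c.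
Proof.
move=> md; rewrite /monom_val (big_fset_incl _ md) // => c _.
by rewrite -cmE_eq0 => /eqP->; rewrite expr0.
Qed.

Lemma monom_val_mmorphism phi : mmorphism (monom_val phi).
Proof.
split=> [m1 m2|]; last by rewrite /monom_val mdom1 big_seq_fset0.
rewrite (@monom_valEw phi (finsupp m1 `|` finsupp m2)%fset) ?mdomD //.
rewrite (monom_valEw phi (fsubsetUl (finsupp m1) (finsupp m2))).
rewrite (monom_valEw phi (fsubsetUr (finsupp m1) (finsupp m2))).
by rewrite -big_split; apply: eq_bigr => c _; rewrite cmM exprD.
Qed.

HB.instance Definition _ phi :=
  monalg.isMultiplicative.Build {cmonom cword} S (monom_val phi)
    (monom_val_mmorphism phi).

Definition pure_val phi : trpure F -> S := mmap iota (monom_val phi).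

HB.instance Definition _ phi := GRing.RMorphism.on (pure_val phi).

Lemma trsubst_pureE phi : trsubst_pure iota tau phi = pure_val phi.
Proof. by []. Qed.

Definition scalar_val phi p : B := (trsubst_pure iota tau phi p)%:A.

Lemma scalar_val_is_additive phi : additive (scalar_val phi).
Proof. by move=> p q; rewrite /scalar_val trsubst_pureE raddfB scalerBl. Qed.

HB.instance Definition _ phi :=
  GRing.isAdditive.Build (trpure F) B (scalar_val phi)
    (scalar_val_is_additive phi).

Definition poly_val phi : trpoly F -> B :=
  mmap (scalar_val phi) (fun w : {fmonom nat} => prodw phi w).

HB.instance Definition _ phi := GRing.Additive.on (poly_val phi).

Lemma trsubstE phi : trsubst iota tau phi = poly_val phi. Proof. by []. Qed.

Lemma trsubstD phi f g : trsubst iota tau phi (f + g)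
  = trsubst iota tau phi f + trsubst iota tau phi g.
Proof. by rewrite trsubstE raddfD. Qed.

Lemma trsubst_sum phi (I : Type) (r : seq I) (G : I -> trpoly F) :
  trsubst iota tau phi (\sum_(i <- r) G i)
    = \sum_(i <- r) trsubst iota tau phi (G i).
Proof. by rewrite trsubstE raddf_sum. Qed.

Lemma trsubst_scale_word phi p w :
  trsubst iota tau phi (p *: word F w)
    = trsubst_pure iota tau phi p *: prodw phi w.
Proof.
have -> : p *: word F w = << p *g FMonom w >>.
  by rewrite wordE -mul_malgC malgUM mul1m mulr1.
rewrite trsubstE /poly_val mmapU /scalar_val.
by rewrite -scalerAl mul1r.
Qed.

Lemma trsubst_pureM phi p q : trsubst_pure iota tau phi (p * q)
  = trsubst_pure iota tau phi p * trsubst_pure iota tau phi q.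
Proof. exact: (rmorphM (pure_val phi)). Qed.

Lemma trsubst_pure_const phi c : trsubst_pure iota tau phi c%:MP = iota c.
Proof. exact: (@mmapC _ _ _ iota (monom_val phi)). Qed.

Lemma trsubst_pure_prod phi (I : Type) (r : seq I) (G : I -> trpure F) :
  trsubst_pure iota tau phi (\prod_(i <- r) G i)
    = \prod_(i <- r) trsubst_pure iota tau phi (G i).
Proof. exact: (rmorph_prod (pure_val phi)). Qed.

Lemma trsubst_pure_trprod phi s : [::] \notin s ->
  trsubst_pure iota tau phi (trprod F s) = \prod_(u <- s) tau (prodw phi u).
Proof.
move=> s0; rewrite trsubst_pure_prod.
apply: eq_big_seq => u us; apply: trsubst_pureTrw => //=.
by apply: contraNneq s0 => <-.
Qed.

Lemma trsubst_mono phi (c : F) s w : [::] \notin s ->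
  trsubst iota tau phi (mono c s w)
    = (iota c * \prod_(u <- s) tau (prodw phi u)) *: prodw phi w.
Proof.
move=> s0; rewrite monoE trsubst_scale_word trsubst_pureM trsubst_pure_const.
by rewrite trsubst_pure_trprod.
Qed.

Lemma trsubst_of_terms phi L : all (@traces_proper F) L ->
  trsubst iota tau phi (of_terms L) = \sum_(x <- L)
    (iota x.1.1 * \prod_(u <- x.1.2) tau (prodw phi u)) *: prodw phi x.2.
Proof.
move=> /allP Lp; rewrite trsubst_sum; apply: eq_big_seq => x xL.
exact/trsubst_mono/Lp.
Qed.

(** A pure term of f would contribute Tr(1) on the left, hence 0, but the trace
    of 1 on the right. *)
Lemma trsubst_Tr phi f : no_pure_term f ->
  trsubst_pure iota tau phi (Tr f) = tau (trsubst iota tau phi f).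
Proof.
move=> f0; rewrite trsubstE /poly_val mmapE raddf_sum /Tr mmapE.
rewrite trsubst_pureE raddf_sum; apply: eq_big_seq => w wf /=.
rewrite rmorphM /= -!trsubst_pureE trsubst_pureTrw //.
  by rewrite /scalar_val -scalerAl mul1r linearZ.
apply: contraTneq wf => w0; have -> : w = mone by apply/eqP; rewrite fmP fm1 w0.
by rewrite -mcoeff_neq0 negbK.
Qed.

Lemma trsubst_pureC phi p : trsubst iota tau phi p%:MP
  = (trsubst_pure iota tau phi p)%:A.
Proof.
by rewrite trsubstE /poly_val mmapU /= /prodw fm1 big_nil mulr1.
Qed.

Lemma trsubst_word phi w : trsubst iota tau phi (word F w) = prodw phi w.
Proof.
by rewrite wordE trsubstE /poly_val mmapU /= /scalar_val trsubst_pureE rmorph1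
  scale1r mul1r.
Qed.

Lemma trsubst_var phi i : trsubst iota tau phi (trvar i) = phi i.
Proof. by rewrite -word1 trsubst_word /prodw big_seq1. Qed.

(** Multiplicativity can be checked on products of two monomials, where it only
    needs the scalars to be central in the target. *)
Lemma trsubstM phi f g : trsubst iota tau phi (f * g)
  = trsubst iota tau phi f * trsubst iota tau phi g.
Proof.
rewrite -(termsK f) -(termsK g) /of_terms.
have := traces_proper_terms g; have := traces_proper_terms f.
move: (terms f) (terms g) => L1 L2 /allP p1 /allP p2.
rewrite sum_mul_sum 3!trsubst_sum sum_mul_sum; apply: eq_big_seq => x /p1 px.
rewrite /= trsubst_sum; apply: eq_big_seq => y /p2 py.
have pxy : [::] \notin x.1.2 ++ y.1.2 by rewrite mem_cat negb_or; apply/andP.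
rewrite /mono_of_term monoM (trsubst_mono phi _ _ pxy).
rewrite (trsubst_mono phi x.1.1 x.2 px) (trsubst_mono phi y.1.1 y.2 py).
rewrite big_cat prodw_cat rmorphM /= -scalerAl -scaleBr scalerA.
by rewrite mulrACA.
Qed.

Lemma trsubst_pure_scale phi p f : trsubst iota tau phi (p *: f)
  = trsubst_pure iota tau phi p *: trsubst iota tau phi f.
Proof. by rewrite -mul_malgC trsubstM trsubst_pureC -scalerAl mul1r. Qed.

Lemma eq_trsubst k phi psi L :
    all (@letters_below F k) L -> all (@traces_proper F) L ->
    (forall i, (i < k)%N -> phi i = psi i) ->
  trsubst iota tau phi (of_terms L) = trsubst iota tau psi (of_terms L).
Proof.
move=> /allP Lk Lp e.
have ew w : all (ltn^~ k) w -> prodw phi w = prodw psi w.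
  by move=> /allP wk; apply: eq_big_seq => i /wk; exact: e.
rewrite !trsubst_of_terms //; apply: eq_big_seq => x /Lk.
rewrite /letters_below all_cat => /andP[/allP sk wk].
rewrite ew //; congr (_ * _ *: _); apply: eq_big_seq => u us; rewrite ew //.
apply/allP => i iu; apply: sk; apply/flattenP; by exists u.
Qed.

End SubstitutionTheory.

(** * Endomorphisms of the free algebra with trace *)

Section Substitutions.
Variable F : fieldType.
Implicit Types (f g a : trpoly F) (p q : trpure F) (phi psi : nat -> trpoly F).
Implicit Types (c : F) (u v w : seq nat) (s : seq (seq nat)).

Lemma no_pure_termMl f g : no_pure_term g -> no_pure_term (f * g).
Proof. by move=> /eqP g0; rewrite /no_pure_term mcoeff_moneM g0 mulr0. Qed.

Lemma no_pure_termMr f g : no_pure_term f -> no_pure_term (f * g).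
Proof. by move=> /eqP f0; rewrite /no_pure_term mcoeff_moneM f0 mul0r. Qed.

Lemma no_pure_termZ p f : no_pure_term f -> no_pure_term (p *: f).
Proof. by move=> /eqP f0; rewrite /no_pure_term mcoeffZ f0 mulr0. Qed.

Lemma no_pure_termD f g :
  no_pure_term f -> no_pure_term g -> no_pure_term (f + g).
Proof.
by move=> /eqP f0 /eqP g0; rewrite /no_pure_term mcoeffD f0 g0 addr0.
Qed.

Lemma no_pure_term_word w : w != [::] -> no_pure_term (word F w).
Proof.
move=> w0; rewrite /no_pure_term wordE mcoeffU1.
suff /negbTE -> : FMonom w != mone by [].
by rewrite fmP fm1.
Qed.

Lemma no_pure_term_var i : no_pure_term (trvar i : trpoly F).
Proof. by rewrite -word1; apply: no_pure_term_word. Qed.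

Lemma no_pure_term_prodw phi w : (forall i, no_pure_term (phi i)) ->
  w != [::] -> no_pure_term (prodw phi w).
Proof.
case: w => // i w np _; rewrite /prodw big_cons.
exact: no_pure_termMr.
Qed.

Lemma pureD p q : (p + q)%:MP = p%:MP + q%:MP :> trpoly F.
Proof. exact: raddfD. Qed.

Lemma pureB p q : (p - q)%:MP = p%:MP - q%:MP :> trpoly F.
Proof. exact: raddfB. Qed.

Lemma pureM p q : (p * q)%:MP = p%:MP * q%:MP :> trpoly F.
Proof. exact: rmorphM. Qed.

Lemma pure_sum (T : Type) (r : seq T) (h : T -> trpure F) :
  (\sum_(i <- r) h i)%:MP = \sum_(i <- r) (h i)%:MP :> trpoly F.
Proof. exact: raddf_sum. Qed.

Notation malgCF := (@mkmalgU _ F mone : F -> trpure F).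

Lemma endoB phi f g : endo phi (f - g) = endo phi f - endo phi g.
Proof. exact: (raddfB (poly_val malgCF (@Tr F) phi)). Qed.

Lemma endo_sum phi (I : Type) (r : seq I) (G : I -> trpoly F) :
  endo phi (\sum_(i <- r) G i) = \sum_(i <- r) endo phi (G i).
Proof. exact: trsubst_sum. Qed.

Lemma endoM phi f g : endo phi (f * g) = endo phi f * endo phi g.
Proof. exact: (trsubstM _ (@malg_scalerAr _ _) (@TrC F)). Qed.

Lemma endo_var phi i : endo phi (trvar i) = phi i.
Proof. exact: trsubst_var. Qed.

Lemma endo_comm_vars phi i j :
  endo phi (trvar i * trvar j - trvar j * trvar i)
    = phi i * phi j - phi j * phi i.
Proof.
have endo_vars k l : endo phi (trvar k * trvar l) = phi k * phi l.
  by apply: etrans (endoM _ _ _) _; rewrite !endo_var.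
apply: etrans (endoB _ _ _) _.
exact: congr2 _ (endo_vars i j) (congr1 _ (endo_vars j i)).
Qed.

Lemma endo_pure phi p :
  endo phi p%:MP = (trsubst_pure malgCF (@Tr F) phi p)%:MP.
Proof.
apply: etrans (trsubst_pureC _ _ _ _) _.
by rewrite -mul_malgC mulr1.
Qed.

Lemma endo_Tr phi f : no_pure_term f ->
  endo phi (Tr f)%:MP = (Tr (endo phi f))%:MP.
Proof.
move=> f0; rewrite endo_pure; congr (_%:MP).
exact: (trsubst_Tr _ (@TrC F) phi f0).
Qed.

Lemma endo_mono phi c s w : [::] \notin s ->
  endo phi (mono c s w)
    = (c%:MP * \prod_(u <- s) Tr (prodw phi u)) *: prodw phi w.
Proof. exact: (trsubst_mono _ (@TrC F)). Qed.

Lemma eq_endo k phi psi (L : seq (trterm F)) :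
    all (letters_below k) L -> all (@traces_proper F) L ->
    (forall i, (i < k)%N -> phi i = psi i) ->
  endo phi (of_terms L) = endo psi (of_terms L).
Proof. exact: (eq_trsubst _ (@TrC F)). Qed.

Lemma prodw_trvar w : prodw trvar w = word F w.
Proof. by rewrite word_prod. Qed.

Lemma endo_trvar f : endo trvar f = f.
Proof.
rewrite -(termsK f) endo_sum; apply: eq_big_seq => x.
move=> /(allP (traces_proper_terms f)) xp; rewrite endo_mono //.
have -> : \prod_(u <- x.1.2) Tr (prodw trvar u) = trprod F x.1.2.
  by apply: eq_bigr => u _; rewrite prodw_trvar Tr_word.
by rewrite prodw_trvar -monoE.
Qed.

(** Substitutions compose, because [prodw phi u] has no pure term as soon as u
    is nonempty, so that [trsubst_Tr] applies to it. *)
Lemma trsubst_endo (S : comNzRingType) (B : lalgType S)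
    (iota : {rmorphism F -> S}) (tau : {scalar B}) phi (psi : nat -> B) f :
    (forall (a : S) (x y : B), a *: (x * y) = x * (a *: y)) ->
    (forall a b : B, tau (a * b) = tau (b * a)) ->
    (forall i, no_pure_term (phi i)) ->
  trsubst iota tau psi (endo phi f)
    = trsubst iota tau (fun i => trsubst iota tau psi (phi i)) f.
Proof.
move=> scaleBr tauC np; rewrite -(termsK f) endo_sum !trsubst_sum.
have prod_psi w : trsubst iota tau psi (prodw phi w)
    = prodw (fun i => trsubst iota tau psi (phi i)) w.
  elim: w => [|i w IH].
    by rewrite [prodw phi _]prodw_nil -(word_nil F) trsubst_word !prodw_nil.
  by rewrite !prodw_cons trsubstM // IH.
apply: eq_big_seq => x /(allP (traces_proper_terms f)) xp.
rewrite endo_mono // trsubst_mono // trsubst_pure_scale // prod_psi.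
rewrite trsubst_pureM trsubst_pure_const trsubst_pure_prod.
congr (_ * _ *: _); apply: eq_big_seq => u us.
rewrite trsubst_Tr // ?prod_psi // no_pure_term_prodw //.
by apply: contraNneq xp => <-.
Qed.

End Substitutions.

(** * Separation of powers *)

Section PowerSeparation.
Variables (F : fieldType) (R : nzRingType) (V : lmodType R).
Variables (iota : {rmorphism F -> R}) (W : V -> Prop).
Hypothesis F_char0 : [pchar F] =i pred0.
Hypotheses (W0 : W 0) (WD : forall x y, W x -> W y -> W (x + y)).
Hypothesis WZ : forall c x, W x -> W (iota c *: x).

Lemma exp2_sub_neq0 d e : (d != e)%N -> 2%:R ^+ d - 2%:R ^+ e != 0 :> F.
Proof.
have nat_eq0 := (pcharf0P F).1 F_char0.
have lt_neq0 (a b : nat) : (a < b)%N -> 2%:R ^+ b - 2%:R ^+ a != 0 :> F.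
  move=> ab; have lt_pow : (2 ^ a < 2 ^ b)%N by rewrite ltn_exp2l.
  rewrite -(natrX F 2 a) -(natrX F 2 b) -natrB ?(ltnW lt_pow) //.
  by rewrite nat_eq0 subn_eq0 -ltnNge.
by rewrite neq_ltn => /orP[/lt_neq0|/lt_neq0 //]; rewrite -oppr_eq0 opprB.
Qed.

(** Interpolation: a subspace W that contains all values of a polynomial
    sum_x t ^ (e x) v_x contains every linear combination of its coefficients.
    Induction on a strict bound M + 1 of the exponents: the combination of the
    values at 2 t and t that kills degree M has coefficients
    (2 ^ d - 2 ^ M) v_d, and 2 ^ d <> 2 ^ M for d <> M in characteristic 0. *)
Lemma separate_powers (I : eqType) (L : seq I) (e : I -> nat) (v : I -> V)
    (h : nat -> F) :
    (forall t, W (\sum_(x <- L) iota (t ^+ e x) *: v x)) ->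
  W (\sum_(x <- L) iota (h (e x)) *: v x).
Proof.
have [M eM] : exists M, forall x, x \in L -> (e x < M)%N.
  exists (\max_(x <- L) e x).+1 => x xL; rewrite ltnS.
  exact: (leq_bigmax_seq (F := e)).
have {eM} : forall x, x \in L -> (M <= e x)%N -> v x = 0.
  by move=> x /eM; rewrite ltnNge => /negbTE->.
elim: M v h => [|M IH] v h vM Wv.
  rewrite big_seq big1 // => x xL; by rewrite vM // scaler0.
pose v' x := iota (2%:R ^+ e x - 2%:R ^+ M) *: v x.
(* In degree M the quotient is 0 / 0 = 0, and v' vanishes there. *)
pose h' d := (h d - h M) / (2%:R ^+ d - 2%:R ^+ M).
have Wv' t : W (\sum_(x <- L) iota (t ^+ e x) *: v' x).
  have := WD (Wv (t * 2%:R)) (WZ (- 2%:R ^+ M) (Wv t)).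
  rewrite scaler_sumr -big_split.
  congr W; apply: eq_bigr => x _.
  rewrite /v' /= !scalerA -scalerDl -!rmorphM -rmorphD; congr (iota _ *: _).
  by rewrite exprMn mulrBr mulNr [_ * t ^+ _]mulrC.
have v'M x : x \in L -> (M <= e x)%N -> v' x = 0.
  rewrite /v' => xL; rewrite leq_eqVlt => /predU1P[<-|lt_M].
    by rewrite subrr rmorph0 scale0r.
  by rewrite vM // scaler0.
have := WD (IH v' h' v'M Wv') (WZ (h M) (Wv 1)).
rewrite scaler_sumr -big_split; congr W; apply: eq_bigr => x _.
rewrite /v' /= !scalerA -scalerDl -!rmorphM -rmorphD; congr (iota _ *: _).
rewrite expr1n mulr1 /h'; have [->|eM] := eqVneq (e x) M.
  by rewrite subrr !mul0r add0r.
by rewrite divfK ?subrK // exp2_sub_neq0.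
Qed.

End PowerSeparation.

(** * T-ideals and their homogeneous components *)

Section Ideals.
Variable F : fieldType.
Implicit Types (f g a : trpoly F) (p q : trpure F) (I G : trpoly F -> Prop).

Lemma Ttr_span_ideal G : Ttr_ideal (Ttr_span G).
Proof.
split.
- by move=> I /Ttr_ideal0.
- by move=> f g Gf Gg I TI GI; apply: (Ttr_idealD TI); [apply: Gf|apply: Gg].
- by move=> a f Gf I TI GI; apply: (Ttr_idealMl TI); apply: Gf.
- by move=> f a Gf I TI GI; apply: (Ttr_idealMr TI); apply: Gf.
- by move=> phi f np Gf I TI GI; apply: (Ttr_ideal_endo TI) => //; apply: Gf.
- by move=> f w w0 Gf I TI GI; apply: (Ttr_ideal_TrM TI) => //; apply: Gf.
- by move=> f np Gf I TI GI; apply: (Ttr_ideal_Tr TI) => //; apply: Gf.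
Qed.

Lemma Ttr_span_gen G g : G g -> Ttr_span G g.
Proof. by move=> Gg I _; apply. Qed.

Lemma no_pure_term_fmonom (w : {fmonom nat}) :
  w != mone -> no_pure_term (<< w >> : trpoly F).
Proof. by move=> /negbTE w0; rewrite /no_pure_term mcoeffU1 w0. Qed.

Lemma tr_identity_ideal (A : traceAlgType F) : Ttr_ideal (tr_identity A).
Proof.
have scaleAr (k : F) (x y : A) : k *: (x * y) = x * (k *: y).
  by rewrite scalerAr.
have trC := @tralg_trC F A.
have closed_Tr f : no_pure_term f -> tr_identity A f ->
    tr_identity A (Tr f)%:MP.
  by move=> np Af phi; rewrite trsubst_pureC trsubst_Tr // Af linear0 scale0r.
have closed_Mr f a : tr_identity A f -> tr_identity A (f * a).
  by move=> Af phi; rewrite trsubstM // Af mul0r.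
split=> //.
- by move=> phi; rewrite trsubstE raddf0.
- by move=> f g Af Ag phi; rewrite trsubstD Af Ag addr0.
- by move=> a f Af phi; rewrite trsubstM // Af mulr0.
- by move=> psi f np Af phi; rewrite trsubst_endo.
- move=> f w w0 Af; apply: closed_Tr; last exact: closed_Mr.
  exact/no_pure_termMl/no_pure_term_fmonom.
Qed.

Lemma pure_mulrACA (p1 p2 q1 q2 : trpure F) :
  (p1 * p2) * (q1 * q2) = (p1 * q1) * (p2 * q2).
Proof. exact: mulrACA. Qed.

Section IdealTheory.
Variable I : trpoly F -> Prop.
Hypothesis TI : Ttr_ideal I.

Lemma Ttr_idealZ p f : I f -> I (p *: f).
Proof. by move=> If; rewrite -mul_malgC; apply: (Ttr_idealMl TI). Qed.

Lemma Ttr_idealN f : I f -> I (- f).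
Proof. by move=> If; rewrite -mulN1r; apply: (Ttr_idealMl TI). Qed.

Lemma Ttr_ideal_sum (T : Type) (r : seq T) (P : pred T) (h : T -> trpoly F) :
  (forall x, P x -> I (h x)) -> I (\sum_(x <- r | P x) h x).
Proof.
by move=> Ih; apply: (big_ind I) => //; [apply: Ttr_ideal0|apply: Ttr_idealD].
Qed.

Lemma Ttr_ideal_sum_seq (T : eqType) (r : seq T) (P : pred T)
    (h : T -> trpoly F) :
  (forall x, x \in r -> P x -> I (h x)) -> I (\sum_(x <- r | P x) h x).
Proof.
move=> Ih; rewrite big_seq_cond.
by apply: Ttr_ideal_sum => x /andP[]; apply: Ih.
Qed.

End IdealTheory.

Definition degree (x : trterm F) :=
  (size (flatten x.1.2) + size x.2)%N.

Definition dilation (t : F) (i : nat) : trpoly F :=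
  (t%:MP : trpure F) *: trvar i.

Lemma no_pure_term_dilation t i : no_pure_term (dilation t i).
Proof. exact/no_pure_termZ/no_pure_term_var. Qed.

Lemma prodw_dilation t w :
  prodw (dilation t) w = ((t ^+ size w)%:MP : trpure F) *: word F w.
Proof.
elim: w => [|i w IH]; first by rewrite prodw_nil word_nil mpolyC1E scale1r.
rewrite prodw_cons IH /= exprS malgCM malg_scaleMM.
by congr (_ *: _); rewrite -word1 -word_cat.
Qed.

Lemma prod_Tr_dilation t s :
  \prod_(u <- s) Tr (prodw (dilation t) u)
    = ((t ^+ size (flatten s))%:MP : trpure F) * trprod F s.
Proof.
elim: s => [|u s IH] /=.
  by rewrite /trprod !big_nil mpolyC1E mul1r.
rewrite big_cons IH prodw_dilation trprod_cons linearZ /= Tr_word.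
rewrite size_cat exprD malgCM; exact: pure_mulrACA.
Qed.

Lemma endo_dilation t x : traces_proper x ->
  endo (dilation t) (mono_of_term x)
    = ((t ^+ degree x)%:MP : trpure F) *: mono_of_term x.
Proof.
move=> sp; rewrite /mono_of_term (endo_mono _ _ _ sp) prodw_dilation.
rewrite prod_Tr_dilation monoE /degree exprD malgCM.
exact: scale_regroup.
Qed.

(** The dilations x_i |-> t x_i multiply a monomial of degree d by t ^ d, so a
    subspace stable under them is graded. *)
Lemma homogeneous_parts (W : trpoly F -> Prop) (h : nat -> F) L :
    [pchar F] =i pred0 ->
    W 0 -> (forall f g, W f -> W g -> W (f + g)) ->
    (forall p f, W f -> W (p *: f)) ->
    (forall t f, W f -> W (endo (dilation t) f)) ->
    all (@traces_proper F) L -> W (of_terms L) ->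
  W (\sum_(x <- L) ((h (degree x))%:MP : trpure F) *: mono_of_term x).
Proof.
move=> F0 W0 WD WZ We Lp WL.
apply: (@separate_powers F (trpure F) (trpoly F) (@mkmalgU _ F mone) W F0 W0 WD
  (fun c => WZ _) _ L degree (@mono_of_term F) h) => t.
have := We t _ WL; rewrite /of_terms endo_sum; congr W.
by apply: eq_big_seq => x /(allP Lp) /endo_dilation ->.
Qed.

End Ideals.

(** * Cyclic derivatives and Euler's identity modulo commutators *)

Section MonoTheory.
Variable F : fieldType.
Implicit Types (c a : F) (s : seq (seq nat)) (u w : seq nat).

Lemma monoZ a c s w : (a%:MP : trpure F) *: mono c s w = mono (a * c) s w.
Proof. by rewrite !monoE scalerA malgCM mulrA. Qed.

Lemma mono_cons u c s w : trword F u *: mono c s w = mono c (u :: s) w.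
Proof. by rewrite !monoE scalerA trprod_cons mulrCA. Qed.

Lemma malgCD a c : (a + c)%:MP = a%:MP + c%:MP :> trpure F.
Proof. exact: raddfD. Qed.

Lemma monoD a c s w : mono (a + c) s w = mono a s w + mono c s w.
Proof. by rewrite !monoE -scalerDl -mulrDl malgCD. Qed.

Lemma mono0 s w : mono (0 : F) s w = 0.
Proof. by rewrite monoE malgC0E mul0r scale0r. Qed.

Lemma monoN a s w : mono (- a) s w = - mono a s w.
Proof.
have := monoD (- a) a s w; rewrite addNr mono0 => /esym/eqP.
by rewrite addr_eq0 => /eqP.
Qed.

Lemma mono_sum (T : Type) (r : seq T) (h : T -> F) s w :
  mono (\sum_(i <- r) h i) s w = \sum_(i <- r) mono (h i) s w.
Proof.
apply: (big_morph (fun a => mono a s w)) => [a c|]; first exact: monoD.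
exact: mono0.
Qed.

Lemma mono_word w : mono (1 : F) [::] w = word F w.
Proof. by rewrite monoE /trprod big_nil mulr1 mpolyC1E scale1r. Qed.

Lemma mono_pure c s w : mono c s w = mono c s [::] * word F w.
Proof. by rewrite -(mono_word w) monoM mulr1 cats0. Qed.

Lemma mono_nil c s : mono c s [::] = (c%:MP * trprod F s)%:MP.
Proof. by rewrite monoE word_nil -mul_malgC mulr1. Qed.

End MonoTheory.

Section CyclicDerivative.
Variable F : fieldType.

(** The terms of the derivative of c * Tr(u_1) ... Tr(u_k) with respect to x_i,
    where the derivative of Tr(u) is the w such that Tr(w y) is the linear
    part of Tr(u) after x_i is replaced by x_i + y.  The exact w sums the
    rotations of u starting after each occurrence of x_i; modulo commutators all
    of them equal u with one x_i removed, which is the formula used here. *)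
Fixpoint cyclic_deriv (i : nat) (c : F) (s : seq (seq nat)) :
    seq (trterm F) :=
  if s is u :: s' then
    (c * (count_mem i u)%:R, s', rem i u)
      :: [seq (x.1.1, u :: x.1.2, x.2) | x <- cyclic_deriv i c s']
  else [::].

Lemma traces_proper_cyclic_deriv i c s :
  [::] \notin s -> all (@traces_proper F) (cyclic_deriv i c s).
Proof.
elim: s => //= u s IH; rewrite inE negb_or => /andP[u0 s0].
rewrite {1}/traces_proper /= s0 all_map.
apply/allP => x /(allP (IH s0)); rewrite /= /traces_proper /=.
by rewrite inE negb_or u0.
Qed.

Lemma Tr_of_terms_var (L : seq (trterm F)) i :
  (Tr (of_terms L * trvar i))%:MP
    = \sum_(x <- L) mono x.1.1 (rcons x.2 i :: x.1.2) [::].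
Proof.
elim: L => [|x L IH].
  by rewrite /of_terms !big_nil mul0r linear0 malgC0E.
rewrite big_cons -IH /of_terms big_cons mulrDl linearD /= pureD; congr (_ + _).
by rewrite -word1 -mono_word monoM mulr1 cats0 cats1 Tr_mono.
Qed.

Lemma Tr_cyclic_deriv_cons i c u s :
  (Tr (of_terms (cyclic_deriv i c (u :: s)) * trvar i))%:MP
    = mono (c * (count_mem i u)%:R) (rcons (rem i u) i :: s) [::]
      + trword F u *: (Tr (of_terms (cyclic_deriv i c s) * trvar i))%:MP.
Proof.
apply: etrans _ (congr1 (fun f => _ + trword F u *: f)
  (esym (Tr_of_terms_var (cyclic_deriv i c s) i))).
apply: etrans (Tr_of_terms_var _ _) _; apply: etrans (big_cons _ _ _ _ _ _) _.
congr (_ + _); rewrite big_map scaler_sumr; apply: eq_bigr => x _.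
by rewrite mono_cons !monoE !trprod_cons (mulrCA (trword F u)).
Qed.

End CyclicDerivative.

Section ModuloCommutators.
Variables (F : fieldType) (I : trpoly F -> Prop).
Hypothesis TI : Ttr_ideal I.
Hypothesis I_comm : I (trvar 0 * trvar 1 - trvar 1 * trvar 0).
Implicit Types (c : F) (u v w : seq nat) (s : seq (seq nat)).

Lemma word_comm u v : I (word F u * word F v - word F v * word F u).
Proof.
have [->|u0] := eqVneq u [::].
  by rewrite word_nil mulr1 mul1r subrr; apply: Ttr_ideal0.
have [->|v0] := eqVneq v [::].
  by rewrite word_nil mulr1 mul1r subrr; apply: Ttr_ideal0.
pose phi i := word F (if i == 0%N then u else v).
have np i : no_pure_term (phi i).
  by rewrite /phi; apply: no_pure_term_word; case: ifP.
by have := Ttr_ideal_endo TI np I_comm; rewrite endo_comm_vars.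
Qed.

(** The commutator of two variables generates, by substitution, the commutators
    of all words, and a letter can be moved to the front through the word that
    precedes it. *)
Lemma word_perm w w' : perm_eq w w' -> I (word F w - word F w').
Proof.
elim: w w' => [|i w IH] w' ww'.
  rewrite perm_sym in ww'; rewrite (perm_nilP ww') subrr; exact: Ttr_ideal0.
have iw' : i \in w' by rewrite -(perm_mem ww') mem_head.
case/splitPr: iw' ww' => w1 w2.
rewrite perm_sym perm_catC /= perm_cons perm_catC perm_sym => /IH Iw.
have I_head : I (word F (i :: w) - word F (i :: w1 ++ w2)).
  rewrite (word_cat F [:: i] w) (word_cat F [:: i] (w1 ++ w2)) -mulrBr.
  exact: (Ttr_idealMl TI).
have I_move : I (word F (i :: w1 ++ w2) - word F (w1 ++ i :: w2)).
  have -> : word F (i :: w1 ++ w2) = word F [:: i] * word F w1 * word F w2.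
    by rewrite -(word_cat F [:: i] w1) -word_cat.
  have -> : word F (w1 ++ i :: w2) = word F w1 * word F [:: i] * word F w2.
    by rewrite -(word_cat F w1 [:: i]) -word_cat -catA.
  rewrite -mulrBl; exact/(Ttr_idealMr TI)/word_comm.
by have := Ttr_idealD TI I_head I_move; rewrite addrA subrK.
Qed.

Lemma mono_perm_word c s w w' : perm_eq w w' -> I (mono c s w - mono c s w').
Proof.
move=> /word_perm Iw; rewrite !monoE -scalerBr.
exact: Ttr_idealZ.
Qed.

(** The difference of two nonempty words has no pure term, so the closure of I
    under traces applies to it. *)
Lemma trword_perm u u' :
  perm_eq u u' -> I ((trword F u)%:MP - (trword F u')%:MP).
Proof.
move=> uu'; have [u0|u0] := eqVneq u [::].
  have /perm_nilP -> : perm_eq u' [::] by rewrite -u0 perm_sym.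
  by rewrite u0 subrr; apply: Ttr_ideal0.
have u'0 : u' != [::] by rewrite -size_eq0 -(perm_size uu') size_eq0.
have np : no_pure_term (word F u - word F u').
  rewrite -scaleN1r; apply: no_pure_termD; last apply: no_pure_termZ;
    exact: no_pure_term_word.
have := Ttr_ideal_Tr TI np (word_perm uu').
by rewrite linearB /= !Tr_word pureB.
Qed.

Lemma mono_perm_trace c s u u' : perm_eq u u' ->
  I (mono c (u :: s) [::] - mono c (u' :: s) [::]).
Proof.
move=> /trword_perm Iu; rewrite -!mono_cons -scalerBl.
by rewrite -mul_malgC pureB; apply: (Ttr_idealMr TI).
Qed.

Lemma count_sum N u : all (ltn^~ N) u ->
  (\sum_(i < N) count_mem (i : nat) u = size u)%N.
Proof.
elim: u => [|j u IH] /=; first by rewrite big1.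
move=> /andP[jN uN]; rewrite big_split /= IH // -add1n; congr addn.
rewrite (bigD1 (Ordinal jN)) //= eqxx big1 // => i; rewrite eq_sym.
by move=> /negbTE ij; rewrite -[j]/(val (Ordinal jN)) val_eqE ij.
Qed.

(** Euler's identity: putting x_i back in the derivative with respect to x_i and
    summing over i recovers each monomial as many times as it has letters. *)
Lemma Euler_identity N c s : all (ltn^~ N) (flatten s) ->
  I (\sum_(i < N) (Tr (of_terms (cyclic_deriv i c s) * trvar i))%:MP
     - mono (c * (size (flatten s))%:R) s [::]).
Proof.
elim: s => [|u s IH] /=.
  move=> _; rewrite mulr0 mono0 subr0 big1 => [|i _]; first exact: Ttr_ideal0.
  by rewrite Tr_of_terms_var big_nil.
rewrite all_cat => /andP[uN /IH {}IH].
have E (i : 'I_N) : (Tr (of_terms (cyclic_deriv i c (u :: s)) * trvar i))%:MP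
    = mono (c * (count_mem (i : nat) u)%:R)
        (rcons (rem (i : nat) u) i :: s) [::]
      + trword F u *: (Tr (of_terms (cyclic_deriv i c s) * trvar i))%:MP.
  exact: Tr_cyclic_deriv_cons.
rewrite (eq_bigr _ (fun i _ => E i)) big_split /= -scaler_sumr.
rewrite size_cat natrD mulrDr monoD -!mono_cons opprD addrACA -scalerBr.
apply: (Ttr_idealD TI); last exact: (Ttr_idealZ TI).
rewrite mono_cons -(count_sum uN) natr_sum mulr_sumr mono_sum -sumrB.
apply: (Ttr_ideal_sum TI) => i _.
have [iu|iu] := boolP (val i \in u).
  apply: mono_perm_trace; rewrite perm_rcons perm_sym; exact: perm_to_rem.
by rewrite (count_memPn iu) mulr0 !mono0 subrr; apply: Ttr_ideal0.
Qed.

End ModuloCommutators.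

(** * Evaluation on diagonal matrices, entry by entry *)

Section DiagonalEntries.
Variables (F : fieldType) (n : nat).
Implicit Types (A B : diagmx F n) (l : 'I_n.+1).

Definition diag_entry l A : F := diagmx_val A l l.

Lemma diag_entry1 l : diag_entry l 1 = 1.
Proof. by rewrite /diag_entry (_ : diagmx_val 1 = 1%:M) // mxE eqxx. Qed.

Lemma diag_entryM l A B :
  diag_entry l (A * B) = diag_entry l A * diag_entry l B.
Proof.
rewrite /diag_entry (_ : diagmx_val (A * B) = diagmx_val A *m diagmx_val B) //.
case: A B => [A dA] [B dB] /=.
have [d ->] := diag_mxP _ dA; have [e ->] := diag_mxP _ dB.
by rewrite mulmx_diag !mxE eqxx !mulr1n.
Qed.

Lemma diag_entryZ l (a : F) A : diag_entry l (a *: A) = a * diag_entry l A.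
Proof.
by rewrite /diag_entry (_ : diagmx_val _ = a *: diagmx_val A) // mxE.
Qed.

Lemma diag_entryD l A B :
  diag_entry l (A + B) = diag_entry l A + diag_entry l B.
Proof.
by rewrite /diag_entry (_ : diagmx_val _ = diagmx_val A + diagmx_val B) // mxE.
Qed.

Lemma diag_entry0 l : diag_entry l 0 = 0.
Proof. by rewrite /diag_entry (_ : diagmx_val 0 = 0) // mxE. Qed.

Lemma diag_entry_prodw l (phi : nat -> diagmx F n) u :
  diag_entry l (prodw phi u) = \prod_(i <- u) diag_entry l (phi i).
Proof.
elim: u => [|i u IH]; first by rewrite prodw_nil diag_entry1 big_nil.
by rewrite prodw_cons diag_entryM IH big_cons.
Qed.

Lemma diag_entry_eq0 A : (forall l, diag_entry l A = 0) -> A = 0.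
Proof.
move=> A0; apply/val_inj/matrixP => i j /=.
rewrite [RHS](_ : _ = (0 : 'M[F]_n.+1) i j) // [RHS]mxE.
have [<-|ij] := eqVneq i j; first exact: A0.
by case: A {A0} => A /= /is_diag_mxP; apply.
Qed.

End DiagonalEntries.

(** The value of Tr(u) when the variable x_i is the diagonal matrix with entries
    v i l and the trace has weights a.  The coefficients are not restricted to a
    field in order to allow matrices of polynomials. *)
Definition weighted_sum (R : pzRingType) (n : nat) (a : 'I_n -> R)
  (v : nat -> 'I_n -> R) (u : seq nat) : R :=
  \sum_l a l * \prod_(i <- u) v i l.

Lemma tr_identity_of_terms (F : fieldType) (n : nat) (alpha : 'I_n.+1 -> F)
    (L : seq (trterm F)) : all (@traces_proper F) L ->
  tr_identity (diagmx_tr alpha) (of_terms L) <->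
  forall (v : nat -> 'I_n.+1 -> F) l, \sum_(x <- L)
    x.1.1 * (\prod_(u <- x.1.2) weighted_sum alpha v u)
      * \prod_(i <- x.2) v i l = 0.
Proof.
move=> Lp; have trC := @tralg_trC F (diagmx_tr alpha).
have entryE (phi : nat -> diagmx F n) l :
    diag_entry l
      (trsubst idfun (@tralg_tr F (diagmx_tr alpha)) phi (of_terms L))
  = \sum_(x <- L) x.1.1
      * (\prod_(u <- x.1.2)
           weighted_sum alpha (fun i k => diag_entry k (phi i)) u)
      * \prod_(i <- x.2) diag_entry l (phi i).
  rewrite trsubst_of_terms //.
  rewrite (big_morph (diag_entry l) (diag_entryD l) (diag_entry0 _ l)).
  apply: eq_bigr => x _; rewrite diag_entryZ diag_entry_prodw.
  congr (_ * _ * _).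
  apply: eq_bigr => u _; rewrite /= /wtrace /weighted_sum.
  by apply: eq_bigr => k _; rewrite -diag_entry_prodw.
split=> [idL v l|idL phi].
  have dv i : is_diag_mx (diag_mx (\row_k v i k)) by exact: diag_mx_is_diag.
  pose phi i : diagmx F n := DiagMx (dv i).
  have phiE i k : diag_entry k (phi i) = v i k.
    by rewrite /diag_entry /= !mxE eqxx mulr1n.
  have := entryE phi l; rewrite idL diag_entry0 => e; rewrite [RHS]e.
  apply: eq_bigr => x _; congr (_ * _ * _).
    apply: eq_bigr => u _; apply: eq_bigr => k _; congr (_ * _).
    by apply: eq_bigr => i _; rewrite phiE.
  by apply: eq_bigr => i _; rewrite phiE.
by apply: diag_entry_eq0 => l; rewrite entryE; exact: idL.
Qed.

(** * Cyclic derivatives of pure identities *)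

Lemma poly_eq0_char0 (F : fieldType) (p : {poly F}) :
  [pchar F] =i pred0 -> (forall t, p.[t] = 0) -> p = 0.
Proof.
move=> F0 p0; have nat_eq0 := (pcharf0P F).1 F0.
apply: (roots_geq_poly_eq0 (rs := [seq k%:R | k <- iota 0 (size p)])).
- by apply/allP => _ /mapP[k _ ->]; rewrite rootE p0.
- rewrite map_inj_uniq ?iota_uniq // => k m.
  wlog: k m / (k <= m)%N => [W|km /eqP].
    by case: (leqP k m) => [/W|/ltnW/W W' /esym/W'].
  rewrite eq_sym -subr_eq0 -natrB // nat_eq0 subn_eq0 => mk.
  by apply/eqP; rewrite eqn_leq km.
- by rewrite size_map size_iota.
Qed.

Section Derivative.
Variables (F : fieldType) (n : nat) (alpha : 'I_n.+1 -> F).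
Variables (v : nat -> 'I_n.+1 -> F) (i : nat) (l : 'I_n.+1).

Definition bump_at j k : bool := (j == i) && (k == l).
(** The point v moved in the direction of one single matrix entry, the entry l
    of the variable x_i. *)
Definition line j k : {poly F} := (v j k)%:P + 'X *+ bump_at j k.
Definition line_weight k : {poly F} := (alpha k)%:P.

Lemma horner_weighted_sum_line u t :
  (weighted_sum line_weight line u).[t]
    = weighted_sum alpha (fun j k => v j k + t *+ bump_at j k) u.
Proof.
rewrite horner_sum; apply: eq_bigr => k _.
rewrite hornerM hornerC horner_prod; congr (_ * _); apply: eq_bigr => j _.
by rewrite hornerD hornerC hornerMn hornerX.
Qed.

Lemma deriv_prod_line u k : (\prod_(j <- u) line j k)^`().[0]
  = ((count_mem i u)%:R * \prod_(j <- rem i u) v j l) *+ (k == l).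
Proof.
elim: u => [|j u IH]; first by rewrite !big_nil derivC horner0 mul0r mul0rn.
rewrite big_cons derivM hornerD !hornerM IH derivD derivC add0r derivMn derivX.
rewrite hornerMn hornerC hornerD hornerC hornerMn hornerX mul0rn addr0.
have -> : (\prod_(m <- u) line m k).[0] = \prod_(m <- u) v m k.
  rewrite horner_prod; apply: eq_bigr => m _.
  by rewrite hornerD hornerC hornerMn hornerX mul0rn addr0.
rewrite /bump_at /= natrD mulrDl; have [->|kl] := eqVneq k l; last first.
  by rewrite andbF !mulr0n mul0r mulr0 addr0.
rewrite andbT !mulr1n.
have [->|ji] := eqVneq j i; rewrite ?mulr1n ?mulr0n ?mul0r ?add0r.
  congr (_ + _); have [iu|iu] := boolP (i \in u).
    by rewrite mulrCA [in RHS](big_rem i iu).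
  by rewrite (count_memPn iu) !mul0r mulr0.
by rewrite big_cons mulrCA.
Qed.

Lemma deriv_weighted_sum_line u : (weighted_sum line_weight line u)^`().[0]
  = alpha l * ((count_mem i u)%:R * \prod_(j <- rem i u) v j l).
Proof.
rewrite /weighted_sum raddf_sum horner_sum (bigD1 l) //=.
rewrite [X in _ + X]big1 ?addr0 => [|k kl].
  by rewrite derivM derivC mul0r add0r hornerM hornerC deriv_prod_line eqxx.
by rewrite derivM derivC mul0r add0r hornerM deriv_prod_line (negbTE kl) mulr0.
Qed.

Lemma weighted_sum_line_at0 u :
  (weighted_sum line_weight line u).[0] = weighted_sum alpha v u.
Proof.
rewrite horner_weighted_sum_line; apply: eq_bigr => k _; congr (_ * _).
by apply: eq_bigr => j _; rewrite mul0rn addr0.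
Qed.

(** The partial derivative of the value of a pure polynomial with respect to the
    entry l of x_i is alpha_l times the entry l of its cyclic derivative: the
    trace turns a gradient into a diagonal matrix. *)
Lemma deriv_trace_product c s :
  (c%:P * \prod_(u <- s) weighted_sum line_weight line u)^`().[0]
    = alpha l * \sum_(x <- cyclic_deriv i c s)
        x.1.1 * (\prod_(u <- x.1.2) weighted_sum alpha v u)
          * \prod_(j <- x.2) v j l.
Proof.
elim: s => [|u s IH]; first by rewrite !big_nil mulr1 derivC horner0 mulr0.
rewrite big_cons mulrCA derivM hornerD !hornerM IH deriv_weighted_sum_line.
rewrite weighted_sum_line_at0 hornerC /= [in RHS]big_cons /= big_map mulrDr.
have -> : (\prod_(w <- s) weighted_sum line_weight line w).[0]
    = \prod_(w <- s) weighted_sum alpha v w.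
  by rewrite horner_prod; apply: eq_bigr => w _; exact: weighted_sum_line_at0.
congr (_ + _).
  rewrite -!mulrA; congr (_ * _); rewrite [RHS]mulrCA; congr (_ * _).
  by rewrite mulrCA; congr (_ * _); exact: mulrC.
rewrite mulrCA; congr (_ * _); rewrite mulr_sumr; apply: eq_bigr => x _ /=.
by rewrite big_cons -!mulrA [RHS]mulrCA.
Qed.

End Derivative.

(** A pure identity is a polynomial in the matrix entries that vanishes
    everywhere, so its partial derivatives vanish too; as the weights are not
    zero, [deriv_trace_product] lets one divide by them.  This is where the
    nondegeneracy of the trace enters. *)
Lemma cyclic_deriv_identity (F : fieldType) (n : nat) (alpha : 'I_n.+1 -> F)
    (i : nat) (L : seq (trterm F)) :
    [pchar F] =i pred0 -> (forall l, alpha l != 0) ->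
    all (@traces_proper F) L -> (forall x, x \in L -> x.2 = [::]) ->
    tr_identity (diagmx_tr alpha) (of_terms L) ->
  tr_identity (diagmx_tr alpha)
    (of_terms (flatten [seq cyclic_deriv i x.1.1 x.1.2 | x <- L])).
Proof.
move=> F0 alpha0 Lp Lpure /(tr_identity_of_terms _ Lp) idL.
apply/tr_identity_of_terms.
  apply/allP => y /flattenP[/= r /mapP[x xL ->]].
  exact/allP/traces_proper_cyclic_deriv/(allP Lp).
move=> v l; apply: (mulfI (alpha0 l)); rewrite mulr0.
rewrite big_flatten big_map mulr_sumr.
(* The value of the identity along the line has derivative alpha_l times the
   sum to be computed. *)
pose Q : {poly F} := \sum_(x <- L) x.1.1%:P * \prod_(u <- x.1.2)
   weighted_sum (line_weight alpha) (line v i l) u.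
have Q0 : Q = 0.
  apply: poly_eq0_char0 => // t; rewrite horner_sum.
  rewrite -[RHS](idL (fun j k => v j k + t *+ bump_at i l j k) ord0).
  apply: eq_big_seq => x xL; rewrite (Lpure x xL) big_nil mulr1.
  rewrite hornerM hornerC horner_prod; congr (_ * _); apply: eq_bigr => u _.
  exact: horner_weighted_sum_line.
have : Q^`().[0] = 0 by rewrite Q0 deriv0 horner0.
rewrite raddf_sum horner_sum => QL; rewrite -[RHS]QL.
by apply: eq_bigr => x _; rewrite deriv_trace_product.
Qed.

(** * The filtration by degree *)

Section Order.
Variable F : fieldType.
Implicit Types (f g : trpoly F) (p q : trpure F) (d e : nat).
Implicit Types (L : seq (trterm F)).

Definition order_ge d f :=
  exists L, [/\ all (@traces_proper F) L, all (fun x => d <= degree x)%N L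
    & f = of_terms L].

Lemma order_ge0 d : order_ge d 0.
Proof. by exists [::]; split=> //; rewrite /of_terms big_nil. Qed.

Lemma order_geD d f g : order_ge d f -> order_ge d g -> order_ge d (f + g).
Proof.
move=> [L1 [p1 d1 ->]] [L2 [p2 d2 ->]]; exists (L1 ++ L2).
by rewrite !all_cat p1 p2 d1 d2 of_terms_cat.
Qed.

Lemma order_ge_sum_seq d (T : eqType) (r : seq T) (h : T -> trpoly F) :
  (forall x, x \in r -> order_ge d (h x)) -> order_ge d (\sum_(x <- r) h x).
Proof.
move=> hd; rewrite big_seq; apply: (big_ind (order_ge d)) => //.
  exact: order_ge0.
exact: order_geD.
Qed.

Lemma order_ge_mono c s w d : [::] \notin s ->
  (d <= size (flatten s) + size w)%N -> order_ge d (mono c s w).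
Proof.
move=> s0 dx; exists [:: (c, s, w)].
by rewrite /= /traces_proper /degree /= s0 dx /of_terms big_seq1.
Qed.

Lemma order_geM d e f g :
  order_ge d f -> order_ge e g -> order_ge (d + e) (f * g).
Proof.
move=> [L1 [p1 d1 ->]] [L2 [p2 d2 ->]]; rewrite /of_terms sum_mul_sum.
apply: order_ge_sum_seq => x xL; apply: order_ge_sum_seq => y yL.
have := allP d1 x xL; have := allP d2 y yL; rewrite /degree => dy dx.
rewrite /mono_of_term monoM; apply: order_ge_mono.
  rewrite mem_cat negb_or; apply/andP.
  by split; [exact: (allP p1)|exact: (allP p2)].
by rewrite flatten_cat !size_cat addnACA leq_add.
Qed.

Lemma order_ge_any f : order_ge 0 f.
Proof.
exists (terms f); rewrite termsK traces_proper_terms; split=> //.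
exact/allP.
Qed.

Lemma order_geZ d p f : order_ge d f -> order_ge d (p *: f).
Proof.
by rewrite -mul_malgC => /(order_geM (order_ge_any p%:MP)); rewrite add0n.
Qed.

(** If the outer word of a monomial is empty, its trace is 0 by the convention
    on Tr(1); otherwise taking the trace preserves the degree. *)
Lemma order_ge_Tr d f : order_ge d f -> order_ge d (Tr f)%:MP.
Proof.
move=> [L [pL dL ->]]; rewrite /of_terms linear_sum pure_sum.
apply: order_ge_sum_seq => x xL.
have dx := allP dL x xL; have px := allP pL x xL.
rewrite /mono_of_term Tr_mono; have [w0|w0] := eqVneq x.2 [::].
  rewrite w0 -mono_cons trword_nil scale0r; exact: order_ge0.
apply: order_ge_mono; first by rewrite inE negb_or eq_sym w0.
by rewrite /= size_cat addn0 addnC.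
Qed.

Lemma order_ge1 f : no_pure_term f -> order_ge 1 f.
Proof.
move=> f0; exists (terms f); rewrite termsK traces_proper_terms; split=> //.
apply/allP => x /flattenP[/= y /mapP[w wf ->]] /mapP[m _ ->].
rewrite /degree /= addn_gt0; apply/orP; right; rewrite lt0n size_eq0.
apply/eqP => w0; have w1 : w = mone by apply/eqP; rewrite fmP fm1; apply/eqP.
have : w \in msupp f by []; rewrite -mcoeff_neq0 w1.
by rewrite (eqP f0) eqxx.
Qed.

Lemma order_ge_prodw phi w : (forall i, no_pure_term (phi i)) ->
  order_ge (size w) (prodw phi w).
Proof.
move=> np; elim: w => [|i w IH]; first exact: order_ge_any.
by rewrite prodw_cons -[size _]add1n; apply: order_geM => //; apply: order_ge1.
Qed.

(** Variables are replaced by elements of order at least 1, so no monomial loses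
    degree. *)
Lemma order_ge_endo phi d f : (forall i, no_pure_term (phi i)) ->
  order_ge d f -> order_ge d (endo phi f).
Proof.
move=> np [L [pL dL ->]]; rewrite /of_terms endo_sum.
apply: order_ge_sum_seq => x xL; have dx := allP dL x xL.
rewrite /mono_of_term endo_mono; last exact: (allP pL).
have prodT (s : seq (seq nat)) :
    order_ge (size (flatten s)) (\prod_(u <- s) Tr (prodw phi u))%:MP.
  elim: s => [|u s IH]; first exact: order_ge_any.
  rewrite big_cons (pureM (Tr (prodw phi u))) [flatten _]/= size_cat.
  apply: order_geM; last exact: IH.
  exact/order_ge_Tr/order_ge_prodw.
have : order_ge (degree x) (((x.1.1)%:MP : trpure F) *:
    ((\prod_(u <- x.1.2) Tr (prodw phi u))%:MP * prodw phi x.2)).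
  by apply/order_geZ/order_geM => //; exact: order_ge_prodw.
rewrite mul_malgC scalerA => -[L' [pL' dL' ->]]; exists L'; split=> //.
by apply: sub_all dL' => y; exact: leq_trans.
Qed.

End Order.

(** * Approximation of an ideal by elements of high order *)

Section Helpers.
Variable F : fieldType.
Implicit Types (f g a : trpoly F) (p q : trpure F).
Implicit Types (L : seq (trterm F)).

Lemma exists_letters_bound L : exists N, all (letters_below N) L.
Proof.
exists (\max_(i <- flatten [seq flatten x.1.2 ++ x.2 | x <- L]) i).+1.
apply/allP => x xL; apply/allP => i ix; rewrite /= ltnS.
apply: (leq_bigmax_seq (F := id)) => //.
by apply/flattenP; exists (flatten x.1.2 ++ x.2) => //; apply: map_f.
Qed.

Lemma terms_pure p x : x \in terms p%:MP -> x.2 = [::].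
Proof.
move=> /flattenP[/= y /mapP[w wp ->]] /mapP[m _ ->] /=.
have /(fsubsetP (msuppC_le _)) : w \in msupp (p%:MP : trpoly F) by [].
by rewrite in_fset1 => /eqP->; rewrite fm1.
Qed.

Lemma Tr_pureM p f : Tr (p%:MP * f) = p * Tr f.
Proof. by rewrite mul_malgC linearZ. Qed.

(** Products with an arbitrary a are obtained by substitution from the product
    with a variable that does not occur in f. *)
Lemma Tr_endo_mul phi f a N :
    (forall i, no_pure_term (phi i)) -> no_pure_term a ->
    all (letters_below N) (terms f) ->
  (Tr (endo phi f * a))%:MP
    = endo (fun i => if (i < N)%N then phi i else a) (Tr (f * trvar N))%:MP.
Proof.
move=> np na fN; set psi := fun i : nat => if (i < N)%N then phi i else a.
have ef : endo psi f = endo phi f.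
  rewrite -(termsK f); apply: eq_endo fN (traces_proper_terms f) _ => i iN.
  by rewrite /psi iN.
have npf : no_pure_term (f * trvar N) by apply/no_pure_termMl/no_pure_term_var.
have e : endo psi (f * trvar N) = endo phi f * a.
  by apply: etrans (endoM _ _ _) _; rewrite ef endo_var /psi ltnn.
exact: esym (etrans (endo_Tr psi npf) (congr1 (fun g => (Tr g)%:MP) e)).
Qed.

Lemma opp_of_terms L :
  - of_terms L = of_terms [seq (- x.1.1, x.1.2, x.2) | x <- L].
Proof.
rewrite /of_terms big_map -sumrN; apply: eq_bigr => x _.
exact: esym (monoN _ _ _).
Qed.

End Helpers.

Section Approximation.
Variables (F : fieldType) (J : trpoly F -> Prop).
Hypothesis TJ : Ttr_ideal J.
Implicit Types (f g : trpoly F) (p : trpure F) (d : nat).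

(** This relation inherits from J the stability under products and
    substitutions, but not under traces: an f without pure term may only be
    approximated by elements of J that have one. *)
Definition near d f := exists2 j, J j & order_ge d (f - j).

Lemma near_ideal d j : J j -> near d j.
Proof. by move=> Jj; exists j => //; rewrite subrr; apply: order_ge0. Qed.

Lemma near0 d : near d 0.
Proof. exact: near_ideal (Ttr_ideal0 TJ). Qed.

Lemma near_order d f : order_ge d f -> near d f.
Proof. by exists 0; [apply: Ttr_ideal0 | rewrite subr0]. Qed.

Lemma nearD d f g : near d f -> near d g -> near d (f + g).
Proof.
move=> [j Jj of_] [k Jk og]; exists (j + k); first exact: (Ttr_idealD TJ).
by rewrite opprD addrACA; apply: order_geD.
Qed.

Lemma nearMl d e f g : order_ge d f -> near e g -> near (d + e) (f * g).
Proof.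
move=> df [j Jj og]; exists (f * j); first exact: (Ttr_idealMl TJ).
by rewrite -mulrBr; apply: order_geM.
Qed.

Lemma near_Tr_pureM d p a : no_pure_term a -> near d p%:MP ->
  near d.+1 (Tr (p%:MP * a))%:MP.
Proof.
move=> na np; have o1 := order_ge_Tr (order_ge1 na).
rewrite Tr_pureM (_ : p * Tr a = Tr a * p); last exact: mulrC.
by rewrite (pureM (Tr a) p); exact: nearMl o1 np.
Qed.

Lemma nearZ d p f : near d f -> near d (p *: f).
Proof.
move=> nf; rewrite -mul_malgC -[d]add0n.
by apply: nearMl => //; apply: order_ge_any.
Qed.

Lemma near_endo d phi f : (forall i, no_pure_term (phi i)) ->
  near d f -> near d (endo phi f).
Proof.
move=> np [j Jj of_]; exists (endo phi j); first exact: (Ttr_ideal_endo TJ).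
by rewrite -endoB; apply: order_ge_endo.
Qed.

(** As J is graded, the components of degree less than d of an element of J lie
    in J.  If d exceeds the degree of f, then f is the sum of these components
    for the element of J that approximates it. *)
Lemma near_limit f : [pchar F] =i pred0 -> (forall d, near d f) -> J f.
Proof.
move=> F0 nf.
have [M fM] : exists M, forall x, x \in terms f -> (degree x < M)%N.
  exists (\max_(x <- terms f) degree x).+1 => x xf; rewrite ltnS.
  exact: (leq_bigmax_seq (F := @degree F)).
have [j Jj [L [pL dL fjL]]] := nf M.
pose L' := terms f ++ [seq (- x.1.1, x.1.2, x.2) | x <- L].
have jE : j = of_terms L'.
  by rewrite of_terms_cat termsK -opp_of_terms -fjL subKr.
have pL' : all (@traces_proper F) L'.
  by rewrite all_cat traces_proper_terms all_map.
have JL' : J (of_terms L') by rewrite -jE.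
(* Truncation below degree M fixes f and kills the error term. *)
have := homogeneous_parts (fun d => (d < M)%:R) F0 (Ttr_ideal0 TJ)
  (Ttr_idealD TJ) (Ttr_idealZ TJ)
  (fun t f => Ttr_ideal_endo TJ (@no_pure_term_dilation F t)) pL' JL'.
rewrite big_cat /= big_map.
rewrite [X in _ + X]big_seq [X in _ + X]big1 ?addr0 => [|x xL].
  rewrite -[in X in _ -> X](termsK f); congr J; apply: eq_big_seq => x /fM xM.
  by rewrite xM mpolyC1E scale1r.
by rewrite {1}/degree /= -/(degree x) ltnNge (allP dL x xL) malgC0E scale0r.
Qed.

End Approximation.

(** * Pure identities *)

Lemma Tr_pure0 (F : fieldType) : (Tr (0 : trpoly F))%:MP = 0 :> trpoly F.
Proof. by rewrite linear0 malgC0E. Qed.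

Lemma Tr_sum_mul (F : fieldType) (T : Type) (r : seq T) (h : T -> trpoly F)
    (a : trpoly F) :
  (Tr ((\sum_(x <- r) h x) * a))%:MP
    = \sum_(x <- r) (Tr (h x * a))%:MP :> trpoly F.
Proof.
apply: (big_morph (fun f => (Tr (f * a))%:MP)) => [f g|].
  by rewrite mulrDl linearD /= pureD.
by rewrite mul0r linear0 malgC0E.
Qed.

Section PureIdentities.
Variables (F : fieldType) (n : nat) (alpha : 'I_n.+1 -> F).
Hypothesis F_char0 : [pchar F] =i pred0.
Hypothesis alpha_neq0 : forall l, alpha l != 0.
Let identity := tr_identity (diagmx_tr alpha).

Variables (G J : trpoly F -> Prop).
Hypothesis identity_gen : forall g, identity g <-> Ttr_span G g.
Hypothesis TJ : Ttr_ideal J.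
Hypothesis J_comm : J (trvar 0 * trvar 1 - trvar 1 * trvar 0).
Hypothesis J_gen :
  forall g, G g -> forall a, no_pure_term a -> J (Tr (g * a))%:MP.

(** The elements g such that Tr(g a) is close to J for all a form a T-ideal
    containing the generators of the identities.  The only delicate closure is
    the one under traces: for g = Tr(f) one has Tr(g a) = Tr(f) Tr(a), where
    Tr(f) is a pure identity, close to J up to order m by assumption, and Tr(a)
    has order at least 1. *)
Lemma near_Tr_mul m :
    (forall p, identity p%:MP -> near J m p%:MP) ->
  forall g, identity g ->
  forall a, no_pure_term a -> near J m.+1 (Tr (g * a))%:MP.
Proof.
move=> IH; pose K g := identity g /\
  forall a, no_pure_term a -> near J m.+1 (Tr (g * a))%:MP.
suff TK : Ttr_ideal K.
  have KG g : G g -> K g.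
    move=> Gg; split=> [|a na]; last exact/near_ideal/J_gen.
    by apply/identity_gen; apply: Ttr_span_gen.
  by move=> g /identity_gen Ig; case: (Ig K TK KG).
have TI : Ttr_ideal identity := tr_identity_ideal (diagmx_tr alpha).
split.
- split=> [|a na]; first exact: (Ttr_ideal0 TI).
  by rewrite mul0r Tr_pure0; apply: near0.
- move=> f g [If Kf] [Ig Kg]; split=> [|a na]; first exact: (Ttr_idealD TI).
  by rewrite mulrDl linearD /= pureD; apply: (nearD TJ); [apply: Kf|apply: Kg].
- move=> b f [If Kf]; split=> [|a na]; first exact: (Ttr_idealMl TI).
  (* Tr(b f a) = Tr(f a b) *)
  by rewrite -mulrA TrC -mulrA; apply/Kf/no_pure_termMr.
- move=> f b [If Kf]; split=> [|a na]; first exact: (Ttr_idealMr TI).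
  by rewrite -mulrA; apply/Kf/no_pure_termMl.
- move=> phi f np [If Kf]; split=> [|a na]; first exact: (Ttr_ideal_endo TI).
  have [N fN] := exists_letters_bound (terms f).
  rewrite (Tr_endo_mul np na fN); apply: (near_endo TJ) => [i|].
    by case: ifP.
  exact/Kf/no_pure_term_var.
- move=> f w w0 [If Kf]; split=> [|a na]; first exact: (Ttr_ideal_TrM TI).
  rewrite Tr_pureM mulrC pureM mul_malgC; apply: (nearZ TJ).
  exact/Kf/no_pure_term_fmonom.
- move=> f np [If Kf]; have ITf := Ttr_ideal_Tr TI np If.
  split=> [|a na]; first exact: ITf.
  exact: (near_Tr_pureM TJ na (IH _ ITf)).
Qed.

(** Euler's identity writes the sum of the d p_d, where p_d is the component of
    degree d of p, as a sum of elements Tr(g_i x_i) modulo J, where the cyclic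
    derivatives g_i are identities. *)
Lemma near_Euler d p : identity p%:MP ->
    (forall g, identity g ->
       forall a, no_pure_term a -> near J d (Tr (g * a))%:MP) ->
  near J d (of_terms [seq (x.1.1 * (size (flatten x.1.2))%:R, x.1.2, x.2)
                 | x <- terms p%:MP]).
Proof.
move=> Ip nearT; set L := terms p%:MP.
have Lpure x : x \in L -> x.2 = [::] by exact: terms_pure.
have Lp : all (@traces_proper F) L by exact: traces_proper_terms.
have [N LN] := exists_letters_bound L.
pose g i := of_terms (flatten [seq cyclic_deriv i x.1.1 x.1.2 | x <- L]).
have Ig i : identity (g i).
  by apply: cyclic_deriv_identity => //; rewrite termsK.
pose S := \sum_(i < N) (Tr (g i * trvar i))%:MP : trpoly F.
have nearS : near J d S.
  apply: (big_ind (near J d)) => [||i _].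
  - exact: near0.
  - exact: nearD.
  - exact/nearT/no_pure_term_var.
set E := of_terms _.
have JSE : J (S - E).
  have -> : S = \sum_(x <- L) \sum_(i < N)
      (Tr (of_terms (cyclic_deriv i x.1.1 x.1.2) * trvar i))%:MP.
    rewrite exchange_big; apply: eq_bigr => i _.
    by rewrite /g /of_terms big_flatten big_map; exact: Tr_sum_mul.
  rewrite /E /of_terms big_map -sumrB; apply: (Ttr_ideal_sum_seq TJ) => x xL _.
  rewrite /mono_of_term /= (Lpure x xL); apply: (Euler_identity TJ J_comm).
  by have := allP LN x xL; rewrite /letters_below all_cat => /andP[].
rewrite -[E](subKr S); apply: (nearD TJ) => //.
by apply: near_ideal; apply: (Ttr_idealN TJ).
Qed.

(** The Euler operator kills constants, so they need a separate argument: the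
    constant part is the value at 0. *)
Lemma identity_constant_part p : identity p%:MP ->
  \sum_(x <- terms p%:MP | x.1.2 == [::]) mono_of_term x = 0.
Proof.
move=> Ip; set L := terms _.
have Lp : all (@traces_proper F) L by exact: traces_proper_terms.
have := Ip; rewrite -(termsK p%:MP) => /(tr_identity_of_terms alpha Lp).
move=> /(_ (fun _ _ => 0) ord0) L0.
have cE x : x \in L ->
    x.1.1 * (\prod_(u <- x.1.2) weighted_sum alpha (fun _ _ => 0) u)
      * \prod_(i <- x.2) 0 = x.1.1 *+ (x.1.2 == [::]).
  move=> xL; rewrite (terms_pure xL) big_nil mulr1.
  have := allP Lp x xL; rewrite /traces_proper.
  case: (x.1.2) => [|u s]; first by rewrite big_nil mulr1.
  rewrite inE negb_or big_cons => /andP[u0 _].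
  rewrite /weighted_sum big1 ?mul0r ?mulr0 // => l _.
  by case: u u0 => // i u _; rewrite big_cons mul0r mulr0.
have -> : \sum_(x <- L | x.1.2 == [::]) mono_of_term x
    = mono (\sum_(x <- L | x.1.2 == [::]) x.1.1) [::] [::].
  rewrite -big_filter -[in RHS]big_filter mono_sum big_filter [RHS]big_filter.
  rewrite big_seq_cond [RHS]big_seq_cond; apply: eq_bigr => x /andP[xL /eqP s0].
  by rewrite /mono_of_term s0 (terms_pure xL).
rewrite big_mkcond (_ : \sum_(x <- L) _ = 0) ?mono0 //.
by rewrite -[RHS]L0; apply: eq_big_seq => x /cE ->; case: ifP.
Qed.

Lemma near_pure_identity m p : identity p%:MP -> near J m p%:MP.
Proof.
elim: m p => [|m IH] p Ip.
  by apply: (near_order TJ); apply: order_ge_any.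
have Lpure x : x \in terms p%:MP -> x.2 = [::] by exact: terms_pure.
have nat_eq0 := (pcharf0P F).1 F_char0.
have := near_Euler Ip (near_Tr_mul IH); set L' := map _ _ => nearL'.
have pL' : all (@traces_proper F) L'.
  by rewrite all_map; exact: traces_proper_terms.
(* The weights 1 / d invert the Euler operator in positive degree. *)
have := homogeneous_parts (fun d => d%:R^-1) F_char0 (near0 TJ _)
  (nearD TJ (d := _)) (nearZ TJ (d := _))
  (fun t f => near_endo TJ (@no_pure_term_dilation F t) (f := f)) pL' nearL'.
congr (near J m.+1).
rewrite -[RHS](termsK p%:MP) [RHS](bigID (fun x => x.1.2 == [::])) /=.
rewrite (identity_constant_part Ip) add0r big_map [RHS]big_mkcond.
apply: eq_big_seq => x xL.
rewrite /mono_of_term /degree /= (Lpure x xL) addn0 monoZ.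
have [->|s0] := eqVneq x.1.2 [::]; first by rewrite invr0 mul0r mono0.
rewrite mulrCA mulVf ?mulr1 // nat_eq0.
have := allP (traces_proper_terms p%:MP) x xL; rewrite /traces_proper.
case: (x.1.2) s0 => // u s _; rewrite inE negb_or /= size_cat => /andP[u0 _].
by rewrite addn_eq0 negb_and size_eq0 eq_sym u0.
Qed.

Lemma pure_identity_mem p : identity p%:MP -> J p%:MP.
Proof. by move=> Ip; apply: near_limit => // m; apply: near_pure_identity. Qed.

End PureIdentities.

(** * The coordinate of weight zero *)

Section MonomialSeparation.
Variable F : fieldType.
Hypothesis F_char0 : [pchar F] =i pred0.
Variables (I : eqType) (L : seq I) (c : I -> F) (m : I -> seq nat).

(** Only the letters below N are separated; the predicate P keeps track of those
    already treated.  The values of b at the last letter N are handled by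
    [separate_powers]. *)
Lemma separate_exponents N (P : pred I) w :
    (forall b : nat -> F, \sum_(x <- L | P x)
       c x * \prod_(i < N) b i ^+ count_mem (i : nat) (m x) = 0) ->
  \sum_(x <- L | P x && [forall i : 'I_N, count_mem (i : nat) (m x)
                                           == count_mem (i : nat) w]) c x = 0.
Proof.
elim: N P => [|N IH] P cP.
  rewrite -[RHS](cP (fun _ => 0)); apply: eq_big => [x|x _].
    by rewrite [X in _ && X](_ : _ = true) ?andbT //; apply/forallP => -[].
  by rewrite big_ord0 mulr1.
pose e x := count_mem N (m x).
have := IH (fun x => P x && (e x == count_mem N w)) _.
set S' := \sum_(x <- L | _) _; move=> IH'.
have -> : \sum_(x <- L | P x && [forall i : 'I_N.+1, count_mem (i : nat) (m x)
                                   == count_mem (i : nat) w]) c x = S'.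
  apply: eq_bigl => x; rewrite -andbA; congr (_ && _).
  apply/forallP/andP => [cx|[ex /forallP cx] i].
    split; first exact: (cx ord_max).
    by apply/forallP => i; exact: (cx (widen_ord (leqnSn N) i)).
  have [iN|Ni] := ltnP i N; first exact: (cx (Ordinal iN)).
  have -> : (i : nat) = N by apply/eqP; rewrite eqn_leq Ni -ltnS ltn_ord.
  exact: ex.
apply: IH' => b; pose v x :=
  if P x then c x * \prod_(i < N) b i ^+ count_mem (i : nat) (m x) else 0.
have W0 : (0 : F^o) = 0 by [].
have WD (x y : F^o) : x = 0 -> y = 0 -> x + y = 0.
  by move=> -> ->; rewrite addr0.
have WZ (a : F) (x : F^o) : x = 0 -> idfun a *: x = 0.
  by move=> ->; rewrite scaler0.
have /= := @separate_powers F F F^o idfun (eq^~ 0) F_char0 W0 WD WZ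
  I L e v (fun d => (d == count_mem N w)%:R).
move=> H; rewrite big_mkcondr big_mkcond -[RHS]H => [|t].
  apply: eq_bigr => x _; rewrite /v /GRing.scale /=.
  by case: (P x); case: eqP; rewrite ?mul1r ?mul0r ?mulr0.
rewrite -[RHS](cP (fun i => if i == N then t else b i)) [RHS]big_mkcond.
apply: eq_bigr => x _; rewrite /v /GRing.scale /=.
case: (P x); rewrite ?mulr0 // big_ord_recr /= eqxx [RHS]mulrA [RHS]mulrC.
congr (_ * (_ * _)); apply: eq_bigr => i _.
by rewrite (ltn_eqF (ltn_ord i)).
Qed.

Lemma prod_count N (b : nat -> F) u : all (ltn^~ N) u ->
  \prod_(i <- u) b i = \prod_(i < N) b i ^+ count_mem (i : nat) u.
Proof.
elim: u => [_|j u IH /= /andP[jN uN]].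
  by rewrite big_nil big1 // => i _; rewrite expr0.
rewrite big_cons IH // [RHS](eq_bigr (fun i : 'I_N => b i ^+ (j == i)%N
    * b i ^+ count_mem (i : nat) u)) => [|i _]; last by rewrite -exprD /=.
rewrite [RHS]big_split /= [X in _ = X * _](bigD1 (Ordinal jN)) //= eqxx.
rewrite [X in _ * X * _]big1 ?mulr1 // => i.
by rewrite eq_sym => /negbTE ij; rewrite -[j]/(val (Ordinal jN)) val_eqE ij.
Qed.

(** Distinct commutative monomials are linearly independent as functions over an
    infinite field. *)
Lemma separate_monomials w :
    (forall b : nat -> F, \sum_(x <- L) c x * \prod_(i <- m x) b i = 0) ->
  \sum_(x <- L | perm_eq (m x) w) c x = 0.
Proof.
move=> cL; pose N := (\max_(i <- w ++ flatten [seq m x | x <- L]) i).+1.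
have ltN i : i \in w ++ flatten [seq m x | x <- L] -> (i < N)%N.
  by move=> iw; rewrite ltnS; apply: (leq_bigmax_seq (F := id)).
have mN x : x \in L -> all (ltn^~ N) (m x).
  move=> xL; apply/allP => i ix; apply: ltN; rewrite mem_cat.
  by apply/orP; right; apply/flattenP; exists (m x); rewrite ?map_f.
have wN i : i \in w -> (i < N)%N by move=> iw; apply: ltN; rewrite mem_cat iw.
rewrite -[RHS](@separate_exponents N xpredT w) => [|b].
  rewrite big_seq_cond [RHS]big_seq_cond; apply: eq_bigl => x.
  apply: andb_id2l => xL /=; apply/permP/forallP => [e i|e].
    by rewrite e.
  apply/permP; rewrite /perm_eq; apply/allP => i; rewrite mem_cat => iN.
  have iN' : (i < N)%N by case/orP: iN => [/(allP (mN x xL))|/wN].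
  exact: (e (Ordinal iN')).
rewrite -[RHS](cL b) big_seq_cond [RHS]big_seq_cond.
by apply: eq_big => // x /andP[/mN xN _]; rewrite (prod_count _ xN).
Qed.

End MonomialSeparation.

Section ExtraZeroWeight.
Variables (F : fieldType) (n : nat) (alpha : 'I_n.+1 -> F).
Implicit Types (f g : trpoly F) (u w : seq nat).

(** The last coordinate is invisible to the trace. *)
Lemma weighted_sum_rcons0 (v : nat -> 'I_n.+2 -> F) u :
  weighted_sum (rcons0 alpha) v u
    = weighted_sum alpha (fun i l => v i (lift ord_max l)) u.
Proof.
rewrite /weighted_sum big_ord_recr /= {2}/rcons0 unlift_none mul0r addr0.
apply: eq_bigr => l _; have -> : widen_ord (leqnSn n.+1) l = lift ord_max l.
  by apply: val_inj; exact: esym (lift_max l).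
by rewrite /rcons0 liftK.
Qed.

Lemma comm_identity : tr_identity (diagmx_tr (rcons0 alpha))
  (trvar 0 * trvar 1 - trvar 1 * trvar 0).
Proof.
have -> : trvar 0 * trvar 1 - trvar 1 * trvar 0
    = of_terms [:: (1 : F, [::], [:: 0; 1]%N); (- 1, [::], [:: 1; 0]%N)].
  rewrite /of_terms big_cons big_seq1 /mono_of_term /= monoN !mono_word -!word1.
  by rewrite -!word_cat.
apply/tr_identity_of_terms => // v l.
rewrite !big_cons !big_nil /= !mulr1 mul1r mulN1r addr0.
by rewrite (mulrC (v 0%N l)) subrr.
Qed.

(** The trace only sees the first coordinates, and there f vanishes. *)
Lemma Tr_mul_var_identity f k : tr_identity (diagmx_tr alpha) f ->
  tr_identity (diagmx_tr (rcons0 alpha)) (Tr (f * trvar k))%:MP.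
Proof.
rewrite -{1}(termsK f) => /(tr_identity_of_terms _ (traces_proper_terms f)) idf.
have -> : (Tr (f * trvar k))%:MP
    = of_terms [seq (x.1.1, rcons x.2 k :: x.1.2, [::]) | x <- terms f].
  by rewrite -{1}(termsK f) Tr_of_terms_var /of_terms big_map.
apply/tr_identity_of_terms => [|v l].
  rewrite all_map; apply/allP => x /(allP (traces_proper_terms f)).
  by rewrite /= /traces_proper /= inE negb_or => ->; case: (x.2).
pose v' i j := v i (lift ord_max j).
rewrite big_map (eq_bigr (fun x => \sum_j (alpha j * v' k j) *
    (x.1.1 * (\prod_(u <- x.1.2) weighted_sum alpha v' u)
      * \prod_(i <- x.2) v' i j))) => [|x _]; last first.
  have wE u : weighted_sum (rcons0 alpha) v u = weighted_sum alpha v' u.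
    exact: weighted_sum_rcons0.
  rewrite big_nil mulr1 /= big_cons wE (eq_bigr _ (fun u _ => wE u)).
  set B := \prod_(u <- _) _; rewrite mulr_suml mulr_sumr.
  apply: eq_bigr => j _; rewrite -cats1 big_cat big_seq1 /=.
  set A := \prod_(i <- x.2) _; rewrite [A * _]mulrC [x.1.1 * _]mulrCA mulrA.
  rewrite -!mulrA; congr (_ * (_ * _)); rewrite mulrCA.
  by congr (_ * _); exact: mulrC.
rewrite exchange_big big1 // => j _.
by rewrite -mulr_sumr idf mulr0.
Qed.

(** In the last coordinate the variables take values that are independent of all
    traces, so the coefficient of every commutative monomial must vanish, and it
    only depends on the first coordinates. *)
Lemma trace_identity_sections (g : trpoly F) w : [pchar F] =i pred0 ->
    tr_identity (diagmx_tr (rcons0 alpha)) g ->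
  tr_identity (diagmx_tr alpha)
    (\sum_(x <- terms g | perm_eq x.2 w) x.1.1%:MP * trprod F x.1.2)%:MP.
Proof.
move=> F0; rewrite -{1}(termsK g).
move=> /(tr_identity_of_terms _ (traces_proper_terms g)) idg.
pose L := [seq (x.1.1, x.1.2, [::] : seq nat)
            | x <- terms g & perm_eq x.2 w].
have -> : (\sum_(x <- terms g | perm_eq x.2 w) x.1.1%:MP * trprod F x.1.2)%:MP
    = of_terms L.
  rewrite -big_filter pure_sum /of_terms big_map; apply: eq_bigr => x _.
  by rewrite /mono_of_term mono_nil.
apply/tr_identity_of_terms => [|v l].
  rewrite all_map; apply/allP => x; rewrite mem_filter => /andP[_].
  exact: (allP (traces_proper_terms g)).
rewrite big_map big_filter.
rewrite (eq_bigr (fun x => x.1.1 * \prod_(u <- x.1.2) weighted_sum alpha v u));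
  last by move=> x _; rewrite big_nil mulr1.
apply: separate_monomials => // b.
(* The first coordinates are given by v, the last one by b. *)
pose v' i j := if unlift ord_max j is Some j' then v i j' else b i.
rewrite -[RHS](idg v' ord_max); apply: eq_bigr => x _; congr (_ * _ * _).
  apply: eq_bigr => u _; rewrite weighted_sum_rcons0; apply: eq_bigr => j _.
  by congr (_ * _); apply: eq_bigr => i _; rewrite /v' liftK.
by apply: eq_bigr => i _; rewrite /v' unlift_none.
Qed.

End ExtraZeroWeight.

(** Modulo commutators, g is the sum over commutative monomials of a pure
    coefficient times a sorted word. *)
Lemma collect_words (F : fieldType) (J : trpoly F -> Prop) (g : trpoly F) :
    Ttr_ideal J -> J (trvar 0 * trvar 1 - trvar 1 * trvar 0) ->
    (forall w, J (\sum_(x <- terms g | perm_eq x.2 w)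
                     x.1.1%:MP * trprod F x.1.2)%:MP) ->
  J g.
Proof.
move=> TJ Jc Jw; pose key (x : trterm F) := sort leq x.2.
pose h x := mono x.1.1 x.1.2 (key x).
have Jgh : J (g - \sum_(x <- terms g) h x).
  rewrite -{1}(termsK g) /of_terms -sumrB; apply: (Ttr_ideal_sum TJ) => x _.
  by apply: (mono_perm_word TJ Jc); rewrite perm_sym perm_sort.
rewrite -[g](subrK (\sum_(x <- terms g) h x)); apply: (Ttr_idealD TJ) => //.
have -> : \sum_(x <- terms g) h x
    = \sum_(w <- undup [seq key x | x <- terms g])
        \sum_(x <- terms g | key x == w) h x.
  rewrite (exchange_big_dep xpredT) //=; apply: eq_big_seq => x xg.
  rewrite /= big_mkcond (bigD1_seq (key x)) ?undup_uniq ?mem_undup ?map_f //=.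
  by rewrite eqxx big1 ?addr0 // => w; rewrite eq_sym => /negbTE->.
apply: (Ttr_ideal_sum_seq TJ) => w; rewrite mem_undup => /mapP[y _ ->] _.
have -> : \sum_(x <- terms g | key x == key y) h x
    = (\sum_(x <- terms g | perm_eq x.2 y.2) x.1.1%:MP * trprod F x.1.2)%:MP
      * word F (key y).
  rewrite -big_filter -[in RHS]big_filter pure_sum mulr_suml !big_filter.
  apply: eq_big => [x|x /eqP exy].
    exact: (sameP eqP (perm_sortP leq_total leq_trans anti_leq _ _)).
  by rewrite /h mono_pure mono_nil exy.
exact: (Ttr_idealMr TJ).
Qed.

Theorem theorem11 (F : fieldType) (F_char0 : [pchar F] =i pred0)
  (n : nat) (alpha : 'I_n.+1 -> F) (alpha_neq0 : forall i, alpha i != 0)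
  (s : nat) (f : 'I_s -> trpoly F) (k : 'I_s -> nat)
  (f_vars : forall i, vars_below (k i) (f i)) :
  (forall g, tr_identity (diagmx_tr alpha) g <->
     Ttr_span (fun h => (exists i, h = f i) \/
                        h = trvar 0 * trvar 1 - trvar 1 * trvar 0) g) ->
  (forall g, tr_identity (diagmx_tr (rcons0 alpha)) g <->
     Ttr_span (fun h => (exists i, h = (Tr (f i * trvar (k i)))%:MP) \/
                        h = trvar 0 * trvar 1 - trvar 1 * trvar 0) g).
Proof.
set G := fun h => _ \/ _; move=> idG g; set G' := fun h => _ \/ _.
have TJ := Ttr_span_ideal G'.
have J_comm : Ttr_span G' (trvar 0 * trvar 1 - trvar 1 * trvar 0).
  by apply: Ttr_span_gen; right.
have J_gen h : G h -> forall a, no_pure_term a -> Ttr_span G' (Tr (h * a))%:MP.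
  move=> [[i ->]|->] a na; last first.
    apply: (Ttr_ideal_Tr TJ); first exact: no_pure_termMl.
    exact: (Ttr_idealMr TJ).
  rewrite -{1}(endo_trvar (f i)).
  have fk := letters_below_terms (f_vars i).
  rewrite (Tr_endo_mul (@no_pure_term_var F) na fk).
  apply: (Ttr_ideal_endo TJ) => [j|].
    by case: ifP => _ //; exact: no_pure_term_var.
  by apply: Ttr_span_gen; left; exists i.
split=> [idg|].
  apply: (collect_words TJ J_comm) => w.
  apply: (pure_identity_mem F_char0 alpha_neq0 idG TJ J_comm J_gen).
  exact: trace_identity_sections.
move=> /(_ _ (tr_identity_ideal (diagmx_tr (rcons0 alpha)))); apply.
move=> _ [[i ->]| ->]; last exact: comm_identity.
by apply: Tr_mul_var_identity; apply/idG; apply: Ttr_span_gen; left; exists i.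
Qed.
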